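(* Let $X$ be a centered Gaussian process with homogeneous increments, i.e. $\mathbf{E}\left[(X(t)-X(s))^2\right]=\delta^2(|t-s|)$ for a univariate function $\delta^2$ which is increasing and concave. Let $m$ be any real number $>1$. Consider the condition (S) $\delta^2$ is twice differentiable (away from $0$), and for some constant $c<1$, the function $r\mapsto\left|(\delta^2)''(r)\right|$ is decreasing and bounded above by $c\,r^{-2}\delta^2(r)$. If $m$ is not an integer, then $X$ has zero odd $m$-th variation on $[0,T]$ as soon as $\delta(r)=o\left(r^{1/(2m)}\right)$ as $r\to0^+$ and condition (S) holds. If $m$ is an integer, then $X$ has zero odd $m$-th variation on $[0,T]$ as soon as $\delta(r)=o\left(r^{1/(2m)}\right)$ as $r\to0^+$ (without needing condition (S)).
   Context: Fix $T>0$, $\varepsilon_0>0$ and put $T_*=T+\varepsilon_0$. The process $X$ is indexed by $[0,T_*]$ and the univariate function $\delta^2$ is defined on $[0,T_*]$ (with $\delta\ge 0$), so that $X(s+\varepsilon)$ makes sense for $s\in[0,T]$ and $0<\varepsilon\le\varepsilon_0$. It is a standing assumption that the centered Gaussian process $X$ is represented as $X(t)=\int_0^{T_*}G(t,s)\,dW(s)$, where $W$ is a standard Brownian motion and $G$ is a non-random measurable function on $[0,T_*]^2$ with $G(t,\cdot)$ square-integrable for every $t$. For real $m>1$ set $$[X,m]_\varepsilon(T):=\frac1\varepsilon\int_0^T\left|X(s+\varepsilon)-X(s)\right|^m\,\mathrm{sgn}\left(X(s+\varepsilon)-X(s)\right)ds ,$$ where $\mathrm{sgn}(x)=x/|x|$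 for $x\ne0$. $X$ has zero odd $m$-th variation on $[0,T]$ if $\lim_{\varepsilon\to0^+}[X,m]_\varepsilon(T)=0$ in $L^2(\Omega)$. *)

(* Defs.v *)
From HB Require Import structures.
From mathcomp Require Export all_boot all_order all_algebra.
From mathcomp Require Export all_classical all_reals all_analysis.
Export Order.TTheory GRing.Theory Num.Theory.
Export numFieldNormedType.Exports.

Set Implicit Arguments.
Unset Strict Implicit.
Unset Printing Implicit Defensive.

#[export] Set Implicit Arguments.
#[export] Unset Strict Implicit.
#[export] Unset Printing Implicit Defensive.

Local Open Scope classical_set_scope.
Local Open Scope ring_scope.

Section L2_convergence.
Context d (T : measurableType d) (R : realType).
Variable mu : {measure set T -> \bar R}.

Definition cvg_L2 (I : Type) (F : set_system I) (f : I -> T -> R)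
    (g : T -> R) : Prop :=
  [/\ (\forall i \near F, f i \in Lfun mu 2%:E),
      g \in Lfun mu 2%:E
    & 'N[mu]_2%:E[EFin \o (f i \- g)%R]%E @[i --> F] --> 0%E].

End L2_convergence.

Section gaussian_processes.
Context d (Omega : measurableType d) (R : realType).
Variable P : probability Omega R.

(* N(0, s^2). The case s = 0 is separate because the library's normal_prob 0 0
   is the uniform law on [0, 1], not the point mass at 0. *)
Definition centered_normal (s : R) (A : set R) : \bar R :=
  if s == 0 then \d_(0 : R) A else normal_prob 0 s A.

Definition has_centered_normal_law (Y : Omega -> R) (s : R) : Prop :=
  measurable_fun setT Y /\
  forall A : set R, measurable A -> P (Y @^-1` A) = centered_normal s A.

Definition centered_gaussian_process (Ts : R) (X : R -> Omega -> R) : Prop :=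
  forall (n : nat) (t a : 'I_n -> R), (forall i, 0 <= t i <= Ts) ->
  exists s : R, has_centered_normal_law (fun w => \sum_i a i * X (t i) w) s.

(* Some B i may be setT, so the product rule for the whole family covers every
   subfamily. *)
Definition mutually_independent (n : nat) (Y : 'I_n -> Omega -> R) : Prop :=
  forall B : 'I_n -> set R, (forall i, measurable (B i)) ->
  P [set w | forall i, B i (Y i w)] = (\prod_(i < n) P (Y i @^-1` B i))%E.

Definition standard_brownian_motion (Ts : R) (W : R -> Omega -> R) : Prop :=
  [/\ forall t : R, 0 <= t <= Ts -> measurable_fun setT (W t),
      {ae P, forall w, W 0 w = 0},
      forall s t : R, 0 <= s -> s <= t -> t <= Ts ->
        has_centered_normal_law (fun w => W t w - W s w) (Num.sqrt (t - s)),
      forall (n : nat) (t : nat -> R), (forall k, 0 <= t k <= Ts) ->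
        nondecreasing_seq t ->
        mutually_independent (fun (k : 'I_n) w => W (t k.+1) w - W (t k) w)
    & {ae P, forall w, {within `[0, Ts], continuous (W ^~ w)}}].

(* The triple (a, u, v) encodes the step a * 1_(]u, v]); steps may overlap. *)
Definition step_fun (phi : seq (R * R * R)) (s : R) : R :=
  \sum_(q <- phi) q.1.1 * \1_(`]q.1.2, q.2]%classic) s.

Definition step_in (Ts : R) (phi : seq (R * R * R)) : Prop :=
  forall q, q \in phi -> [/\ 0 <= q.1.2, q.1.2 <= q.2 & q.2 <= Ts].

Definition step_integral (W : R -> Omega -> R) (phi : seq (R * R * R))
    (w : Omega) : R :=
  \sum_(q <- phi) q.1.1 * (W q.2 w - W q.1.2 w).

(* Y is (a version of) the integral of g with respect to W over [0, Ts]. By the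
   Ito isometry, the limit does not depend on the approximating sequence. *)
Definition is_wiener_integral (Ts : R) (W : R -> Omega -> R) (g : R -> R)
    (Y : Omega -> R) : Prop :=
  exists phi : nat -> seq (R * R * R),
  [/\ forall n, step_in Ts (phi n),
      cvg_L2 lebesgue_measure \oo (fun n => step_fun (phi n))
        (g \_ `[0, Ts])
    & cvg_L2 P \oo (fun n => step_integral W (phi n)) Y].

Definition wiener_representation (Ts : R) (X : R -> Omega -> R) : Prop :=
  exists (W : R -> Omega -> R) (G : R -> R -> R),
  [/\ standard_brownian_motion Ts W,
      measurable_fun (`[0, Ts] `*` `[0, Ts]) (fun p : R * R => G p.1 p.2),
      forall t : R, 0 <= t <= Ts ->
        lebesgue_measure.-integrable `[0, Ts] (fun s => (G t s ^+ 2)%:E)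
    & forall t : R, 0 <= t <= Ts -> is_wiener_integral Ts W (G t) (X t)].

(* Joint measurability in time and chance, which gives the pathwise Lebesgue
   integral in odd_variation a meaning as a random variable. *)
Definition measurable_process (Ts : R) (X : R -> Omega -> R) : Prop :=
  measurable_fun (`[0, Ts] `*` [set: Omega])
    (fun p : R * Omega => X p.1 p.2).

Definition odd_variation (X : R -> Omega -> R) (m T eps : R) (w : Omega) : R :=
  eps^-1 * \int[lebesgue_measure]_(s in `[0, T])
    (`|X (s + eps) w - X s w| `^ m * Num.sg (X (s + eps) w - X s w)).

Definition zero_odd_variation (X : R -> Omega -> R) (m T : R) : Prop :=
  cvg_L2 P 0^'+ (odd_variation X m T) (cst 0).

End gaussian_processes.

Definition concave_on (R : realType) (Ts : R) (f : R -> R) : Prop :=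
  convex_function (E := R^o) `[0, Ts]%classic (\- f).

Definition condition_S (R : realType) (Ts : R) (f : R -> R) : Prop :=
  let f' := (f^`())%classic in
  let f'' := (f^`(2))%classic in
  [/\ {in `]0, Ts[, forall r : R, derivable f r 1},
      {in `]0, Ts[, forall r : R, derivable f' r 1}
    & exists c : R,
      [/\ c < 1,
          {in `]0, Ts[ &, nonincreasing_fun (fun r => `|f'' r|)}
        & {in `]0, Ts[, forall r, `|f'' r| <= c * r ^- 2 * f r}]].

(* Main.v *)
Require Import Defs.
From mathcomp Require Import measurable_realfun ring lra.

(** Write [phi x] for [|x| ^ m * sgn x] (the function [odd_power] below),
    [Y s = X (s + eps) - X s] and [v = (delta eps) ^ 2], so that every [Y s] is
    centered normal of variance [v].  The second moment of the odd variation is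
    [eps ^ -2] times the double integral over [0, T] of the covariances
    E[phi (Y s) phi (Y t)].

    The probabilistic half is one estimate
    ([gaussian_pair_odd_power_bound]): if Y and Z are jointly Gaussian with
    variance [v] and correlation [rho], then
    |E[phi Y phi Z]| <= K |rho| v ^ m.
    Put N = Z - rho Y, which is uncorrelated with Y.  Since phi is odd,
    E[phi Y phi N] = 0, so that only the difference phi Z - phi N counts; it is
    at most a constant times |rho Y| (|Z| ^ (m - 1) + |N| ^ (m - 1)), and
    Gaussian moments do the rest.

    That E[phi Y phi N] = 0 is a consequence of independence, but joint
    Gaussianity is only given through the laws of the combinations a Y + b N.
    These suffice: a Y + b N and a Y - b N are centered normal with the same
    variance, hence 2 sin (a Y) sin (b N) = cos (a Y - b N) - cos (a Y + b N)
    has mean zero ([gaussian_pair_sin]).  Odd powers of a sine are combinations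
    of sines, and phi is a mixture of such powers: for h = sin ^ (2n+1) with
    2n >= m, the integral of h (a x) a ^ (-m-1) over a > 0 is C phi x with
    C nonzero ([sine_transform], [sine_transform_const_neq0]).  Fubini then carries
    the orthogonality from sines to phi.

    The other half sums the correlations [rho s t] of Y s and Y t.  Concavity
    of [delta ^ 2] makes them nonpositive as soon as |t - s| >= eps, so that
    |rho s t| <= 2 * 1_(|t - s| < eps) - rho s t everywhere.  The double integral
    of [rho] is nonnegative, being 1 / v times the second moment of the integral
    of Y; hence that of |rho| is at most 4 eps T.  Altogether the second moment
    of the odd variation is at most 4 K T (delta eps) ^ (2m) / eps, which tends
    to 0 when [delta r] is small compared with [r ^ (1 / (2m))]. *)

Local Open Scope classical_set_scope.
Local Open Scope ring_scope.

(** * The odd power function *)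

Section odd_power.
Variable R : realType.
Implicit Types (m p q k u v x : R).

Definition odd_power m x : R := `|x| `^ m * Num.sg x.

Lemma odd_power0 m : odd_power m 0 = 0.
Proof. by rewrite /odd_power sgr0 mulr0. Qed.

Lemma odd_powerN m x : odd_power m (- x) = - odd_power m x.
Proof. by rewrite /odd_power normrN sgrN mulrN. Qed.

Lemma ge0_odd_power m x : m != 0 -> 0 <= x -> odd_power m x = x `^ m.
Proof.
move=> m0; rewrite le_eqVlt => /predU1P[<-|x0].
  by rewrite odd_power0 powR0.
by rewrite /odd_power gtr0_norm// gtr0_sg// mulr1.
Qed.

Lemma normr_odd_power m x : m != 0 -> `|odd_power m x| = `|x| `^ m.
Proof.
move=> m0; wlog x0 : x / 0 <= x.
  have [x0|x0] := leP 0 x; first exact.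
  by move=> /(_ (- x)); rewrite odd_powerN !normrN; apply; rewrite oppr_ge0 ltW.
by rewrite ge0_odd_power// ger0_norm// ?powR_ge0// ger0_norm.
Qed.

Lemma measurable_odd_power m : measurable_fun setT (odd_power m).
Proof.
apply: measurable_funM.
  by apply: (@measurableT_comp _ _ _ _ _ _ (@powR R ^~ m)).
rewrite (_ : Num.sg = (fun x => if 0 < x then 1 else if x < 0 then -1 else 0)).
  apply: measurable_fun_ifT => //; first exact: measurable_fun_ltr.
  by apply: measurable_fun_ifT => //; exact: measurable_fun_ltr.
by apply/funext => x; case: sgrP => // ->; rewrite ?ltxx.
Qed.

(** The exponent [n] in place of [m] costs nothing, as only the order of
    magnitude matters later, and it reduces the inequality to natural powers by
    t ^ n <= t ^ m. *)
Lemma bernoulli_powR m t n : 0 < m <= n%:R -> 0 <= t <= 1 ->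
  1 - t `^ m <= n%:R * (1 - t).
Proof.
move=> /andP[m0 mn] /andP[t0 t1].
move: t0; rewrite le_eqVlt => /predU1P[<-|t0].
  by rewrite powR0 ?gt_eqF// !subr0 mulr1; case: n mn => [|n _]; [lra|rewrite ler1n].
apply: (@le_trans _ _ (1 - t ^+ n)).
  rewrite lerD2l lerN2 -powR_mulrn ?(ltW t0)//.
  by apply: (@ger_powR _ t) => //; apply/andP.
elim: n {mn} => [|n IHn]; first by rewrite expr0 mul0r subrr.
have : t ^+ n <= 1 by rewrite exprn_ile1// ltW.
have : 0 <= t ^+ n by rewrite exprn_ge0// ltW.
by rewrite exprS -natr1; nra.
Qed.

(** The mean value theorem with a crude constant; homogeneity reduces it to
    [bernoulli_powR] when [u] and [v] have the same sign. *)
Lemma odd_power_locally_lipschitz m n u v : 1 < m <= n%:R ->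
  `|odd_power m u - odd_power m v| <=
    n%:R * `|u - v| * (`|u| `^ (m - 1) + `|v| `^ (m - 1)).
Proof.
move=> /andP[m1 mn]; have m0 : m != 0 by lra.
wlog vu : u v / `|v| <= `|u|.
  have [vu|uv] := leP `|v| `|u|; first exact.
  by move=> /(_ v u (ltW uv)); rewrite distrC [`|v - u|]distrC [X in _ * X]addrC.
wlog u0 : u v vu / 0 <= u.
  have [u0|u0] := leP 0 u; first exact.
  move=> /(_ (- u) (- v)); rewrite !odd_powerN -!opprD !normrN.
  by apply => //; lra.
rewrite (ger0_norm u0) in vu *.
have E x : 0 <= x -> x `^ m = x * x `^ (m - 1) by move=> x0; rewrite mulr_powRB1; lra.
have P x : 0 <= x `^ (m - 1) by exact: powR_ge0.
rewrite (ge0_odd_power _ u0)//.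
have n1 : 1 <= n%:R :> R by lra.
have [v0|v0] := leP 0 v; last first.
  (* Opposite signs: nothing cancels, and each power x ^ m = x * x ^ (m - 1) is
     bounded on its own. *)
  rewrite -[v]opprK odd_powerN opprK ge0_odd_power//; last lra.
  rewrite opprK (ltr0_norm v0).
  have v'0 : 0 <= - v by lra.
  rewrite !ger0_norm ?addr_ge0 ?powR_ge0// !E//.
  have := P u; have := P (- v); move: v'0 u0 n1; clear.
  move: (- v) (u `^ (m-1)) => w a; move: (w `^ (m-1)) (n%:R : R) => b c.
  move=> w0 u0 c1 b0 a0.
  rewrite -mulrA; apply: (@le_trans _ _ ((u + w) * (a + b))); first nra.
  by rewrite ler_peMl// mulr_ge0// addr_ge0.
rewrite (ger0_norm v0) in vu *.
rewrite (ge0_odd_power _ v0)// !ger0_norm ?subr_ge0//; last first.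
  by rewrite ge0_ler_powR ?nnegrE//; lra.
move: u0; rewrite le_eqVlt => /predU1P[u0|u0].
  have -> : v = 0 by lra.
  by rewrite -u0 subrr mulr_ge0 ?addr_ge0// mulr_ge0// subrr.
have t01 : 0 <= v / u <= 1 by rewrite divr_ge0 ?(ltW u0)//= ler_pdivrMr// mul1r.
have -> : v `^ m = u `^ m * (v / u) `^ m.
  by rewrite -powRM ?divr_ge0 ?(ltW u0)// mulrC divfK// gt_eqF.
rewrite -[X in X - _]mulr1 -mulrBr.
apply: (@le_trans _ _ (u `^ m * (n%:R * (1 - v / u)))).
  by rewrite ler_wpM2l ?powR_ge0// bernoulli_powR// mn; lra.
rewrite E ?(ltW u0)// (_ : u * _ * _ = n%:R * (u - v) * u `^ (m - 1)).
  by rewrite ler_wpM2l ?lerDl// mulr_ge0// subr_ge0.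
by field; rewrite gt_eqF.
Qed.

Lemma normr_powRM_le p q u v : 0 <= p -> 0 <= q ->
  `|u| `^ p * `|v| `^ q <= `|u| `^ (p + q) + `|v| `^ (p + q).
Proof.
move=> p0 q0.
move: (`|u|) (`|v|) (normr_ge0 u) (normr_ge0 v) => {u v} u v u0 v0.
have D x : 0 <= x -> x `^ p * x `^ q <= x `^ (p + q).
  rewrite le_eqVlt => /predU1P[<-|x0]; last first.
    by rewrite powRD// (gt_eqF x0) implybT.
  have [->|] := eqVneq p 0; first by rewrite add0r powRr0 mul1r.
  by move=> p0'; rewrite powR0// mul0r powR_ge0.
have [uv|vu] := leP u v.
  apply: (@le_trans _ _ (v `^ p * v `^ q)).
    by rewrite ler_wpM2r ?powR_ge0// ge0_ler_powR ?nnegrE.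
  by rewrite (le_trans (D _ v0))// lerDr powR_ge0.
apply: (@le_trans _ _ (u `^ p * u `^ q)).
  by rewrite ler_wpM2l ?powR_ge0// ge0_ler_powR ?nnegrE// ltW.
by rewrite (le_trans (D _ u0))// lerDl powR_ge0.
Qed.

End odd_power.

(** * Real-valued integrals *)

Section lebesgue_affine.
Variables (R : realType) (k b : R).
Hypothesis k0 : 0 < k.
Notation mu := (@lebesgue_measure R).
Let aff (x : measurableTypeR R) : measurableTypeR R := k * x + b.

Let measurable_aff : measurable_fun setT aff.
Proof. by apply: measurable_funD => //; exact: measurable_funM. Qed.

(** Both sides are integrals against measures that agree on half-open
    intervals, which determine Lebesgue measure. *)
Lemma ge0_integral_affine (f : R -> \bar R) :
  measurable_fun setT f -> (forall x, 0 <= f x)%E ->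
  (\int[mu]_x f x = k%:E * \int[mu]_x f (k * x + b)%R)%E.
Proof.
move=> mf f0.
pose knng := NngNum (ltW k0).
transitivity (k%:E * \int[mu]_(x in aff @^-1` setT) (f \o aff) x)%E; last first.
  by rewrite preimage_setT.
rewrite -ge0_integral_pushforward// -[k]/(knng%:num) -ge0_integral_mscale//.
apply: eq_measure_integral => A mA _; apply: lebesgue_measure_unique => //.
move=> _ [[a c]] _ <-.
transitivity (k%:E * mu (aff @^-1` `]a, c]%classic))%E; last by [].
have -> : aff @^-1` `]a, c]%classic = `](a - b) / k, (c - b) / k]%classic.
  apply/seteqP; split => x; rewrite /aff /= !in_itv/=;
    by rewrite ltr_pdivrMr// ler_pdivlMr// ltrBlDr lerBrDr mulrC.
rewrite !lebesgue_measure_itv/= !lte_fin ltr_pM2r ?invr_gt0// ltrD2r.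
case: ifP => _; last by rewrite mule0.
rewrite -!EFinB -EFinM; congr (_%:E); field.
by rewrite gt_eqF.
Qed.

End lebesgue_affine.

Notation rintegrable mu f := (mu.-integrable setT (EFin \o f)).

Section real_integrable.
Context d (T : measurableType d) (R : realType).
Variable mu : {measure set T -> \bar R}.
Implicit Types f g : T -> R.

Lemma rintegrable_measurable f : rintegrable mu f -> measurable_fun setT f.
Proof. by move=> /measurable_int /measurable_EFinP. Qed.

Lemma le_rintegrable g f : measurable_fun setT g ->
  (forall x, `|g x| <= f x) -> rintegrable mu f -> rintegrable mu g.
Proof.
move=> mg gf; apply: le_integrable => //; first exact/measurable_EFinP.
by move=> x _; rewrite /= lee_fin (le_trans (gf x))// ler_norm.
Qed.

Lemma rintegrableD f g : rintegrable mu f -> rintegrable mu g ->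
  rintegrable mu (fun x => f x + g x).
Proof. by move=> intf intg; exact: (integrableD measurableT intf intg). Qed.

Lemma rintegrableB f g : rintegrable mu f -> rintegrable mu g ->
  rintegrable mu (fun x => f x - g x).
Proof. by move=> intf intg; exact: (integrableB measurableT intf intg). Qed.

Lemma rintegrableZl k f : rintegrable mu f -> rintegrable mu (fun x => k * f x).
Proof. by move=> intf; exact: (integrableZl measurableT k intf). Qed.

Lemma rintegrable_norm f : rintegrable mu f -> rintegrable mu (fun x => `|f x|).
Proof. by move=> intf; exact: integrable_norm. Qed.

Lemma EFin_Rintegral f : rintegrable mu f ->
  (\int[mu]_x f x)%:E = (\int[mu]_x (f x)%:E)%E.
Proof. by move=> intf; rewrite /Rintegral fineK//; exact: integrable_fin_num. Qed.

Lemma ge0_rintegrableP f : measurable_fun setT f -> (forall x, 0 <= f x) ->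
  rintegrable mu f <-> (\int[mu]_x (f x)%:E < +oo)%E.
Proof.
move=> mf f0; split=> [/integrableP[_]|ioo].
  by under eq_integral do rewrite /= ger0_norm//.
apply/integrableP; split; first exact/measurable_EFinP.
by under eq_integral do rewrite /= ger0_norm//.
Qed.

Lemma eq_rintegrable f g : f =1 g -> rintegrable mu f -> rintegrable mu g.
Proof. by move=> /funext ->. Qed.

Lemma ae_eq_Rintegral f g : rintegrable mu f -> rintegrable mu g ->
  {ae mu, forall x, f x = g x} -> \int[mu]_x f x = \int[mu]_x g x.
Proof.
move=> intf intg fg; congr fine; apply: ae_eq_integral => //.
- exact: measurable_int intf.
- exact: measurable_int intg.
- by apply: filterS fg => w /= -> _.
Qed.

(** Bridges iterated extended-real integrals and iterated real ones: an
    integrable inner integral is infinite on a null set only. *)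
Lemma integrable_fine (F : T -> \bar R) : mu.-integrable setT F ->
  rintegrable mu (fine \o F) /\
  \int[mu]_x fine (F x) = fine (\int[mu]_x F x)%E.
Proof.
move=> intF.
have mF : measurable_fun setT (fine \o F).
  by apply: measurableT_comp => //; exact: measurable_int intF.
have ifF : rintegrable mu (fine \o F).
  apply: (le_integrable _ _ _ intF) => //; first exact/measurable_EFinP.
  by move=> x _ /=; case: (F x) => //= *; rewrite ?normr0 ?leey.
split => //; congr fine; apply: ae_eq_integral => //; first exact: measurable_int ifF.
  exact: measurable_int intF.
have := integrable_ae measurableT intF; apply: filterS => x /= h _.
by rewrite fineK// h.
Qed.

End real_integrable.

Section real_fubini.
Context d1 d2 (T1 : measurableType d1) (T2 : measurableType d2) (R : realType).
Variables (m1 : {sigma_finite_measure set T1 -> \bar R}).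
Variables (m2 : {sigma_finite_measure set T2 -> \bar R}).

Lemma Rintegral_Fubini (A : T1 -> T2 -> R) :
  measurable_fun setT (fun z => A z.1 z.2) ->
  (\int[m1]_x \int[m2]_y `|A x y|%:E < +oo)%E ->
  [/\ rintegrable m1 (fun x => \int[m2]_y A x y),
      rintegrable m2 (fun y => \int[m1]_x A x y)
    & \int[m1]_x (\int[m2]_y A x y) = \int[m2]_y (\int[m1]_x A x y)].
Proof.
move=> mA Aoo.
pose f (z : T1 * T2) := (A z.1 z.2)%:E.
have intf : (m1 \x m2)%E.-integrable setT f.
  by apply/integrable12ltyP => //; exact/measurable_EFinP.
have intF : m1.-integrable setT (fubini_F m2 f) by exact: integrable_fubini_F.
have intG : m2.-integrable setT (fubini_G m1 f).
  apply/integrableP; split; first exact: (measurable_fubini_G intf).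
  apply: le_lt_trans ((integrable21ltyP _ _ (measurable_int _ intf)).1 intf).
  apply: ge0_le_integral => //.
  - by apply: measurableT_comp => //; exact: (measurable_fubini_G intf).
  - apply: (measurable_fun_fubini_tonelli_G (abse \o f)) => //=.
    by apply: measurableT_comp => //; exact: measurable_int intf.
  - move=> y _; apply: le_abse_integral => //.
    by apply: measurableT_comp => //; exact: measurable_int intf.
have [iF EF] := integrable_fine intF.
have [iG EG] := integrable_fine intG.
by split => //; rewrite [LHS]EF [RHS]EG; congr fine; exact: Fubini.
Qed.

End real_fubini.

Section Rintegral_affine.
Variables (R : realType) (k b : R).
Hypothesis k0 : 0 < k.
Notation mu := (@lebesgue_measure R).

Lemma rintegrable_affine (f : R -> R) :
  rintegrable mu f -> rintegrable mu (fun x => f (k * x + b)).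
Proof.
move=> intf; have mf := rintegrable_measurable intf.
have mkb : measurable_fun setT (fun x : R => k * x + b).
  by apply: measurable_funD => //; exact: measurable_funM.
apply/integrableP; split; first exact/measurable_EFinP/measurableT_comp.
have /integrableP[_] := intf.
rewrite (@ge0_integral_affine R k b k0)//; last first.
  by apply/measurable_EFinP; exact: measurableT_comp.
set I := (X in (_ * X < _)%E -> (X < _)%E).
move: I => -[I||]; rewrite ?ltry ?ltNyr//.
by rewrite gt0_muley ?lte_fin.
Qed.

Lemma Rintegral_affine (f : R -> R) : rintegrable mu f ->
  \int[mu]_x f x = k * \int[mu]_x f (k * x + b).
Proof.
wlog f0 : f / forall x, 0 <= f x => [wlg intf|intf].
  have intn := rintegrable_norm intf.
  have intD := rintegrableD intf intn.
  transitivity (\int[mu]_x (f x + `|f x| - `|f x|)).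
    by apply: eq_Rintegral => x _; rewrite addrK.
  rewrite RintegralB// wlg//; last by move=> x; rewrite -lerBlDr sub0r lerNnormlW.
  rewrite [X in _ - X]wlg// -mulrBr -RintegralB//; try exact: rintegrable_affine.
  - by congr (_ * _); apply: eq_Rintegral => x _; rewrite addrK.
  - exact: rintegrable_affine intD.
  - exact: rintegrable_affine intn.
have intk := rintegrable_affine intf.
apply: EFin_inj; rewrite EFinM !EFin_Rintegral// (@ge0_integral_affine R k b)//.
by apply/measurable_EFinP; exact: rintegrable_measurable intf.
Qed.

End Rintegral_affine.

(** * The odd power as a mixture of sines *)

Section sine_transform.
Variable R : realType.
Notation mu := (@lebesgue_measure R).
Implicit Types (m a x : R) (n : nat).

Lemma normr_sin_le x : `|sin x| <= `|x|.
Proof.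
wlog x0 : x / 0 <= x.
  have [x0|x0] := leP 0 x; first exact.
  by move=> /(_ (- x)); rewrite sinN !normrN; apply; rewrite oppr_ge0 ltW.
have [c _] : exists2 c, c \in `[0, x] & sin x - sin 0 = cos c * (x - 0).
  apply: MVT_segment => //.
  by apply: continuous_subspaceT; exact: continuous_sin.
by rewrite sin0 !subr0 => ->; rewrite normrM ler_piMl// cos_max.
Qed.

Definition sine_power n x : R := sin x ^+ n.*2.+1.

Definition kernel_weight m a : R := if 0 < a then a `^ (- (m + 1)) else 0.

Lemma sine_powerN n x : sine_power n (- x) = - sine_power n x.
Proof. by rewrite /sine_power sinN exprNn -signr_odd/= odd_double mulN1r. Qed.

Lemma normr_sine_power_le1 n x : `|sine_power n x| <= 1.
Proof. by rewrite normrX exprn_ile1// sin_max. Qed.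

Lemma measurable_sine_power n : measurable_fun setT (sine_power n).
Proof.
apply: measurable_funX; apply: continuous_measurable_fun.
exact: continuous_sin.
Qed.

Lemma measurable_kernel_weight m : measurable_fun setT (kernel_weight m).
Proof. by apply: measurable_fun_ifT => //; exact: measurable_fun_ltr. Qed.

Lemma kernel_weight_ge0 m a : 0 <= kernel_weight m a.
Proof. by rewrite /kernel_weight; case: ifP => // _; rewrite powR_ge0. Qed.

Lemma kernel_weightM m a x : 0 < x ->
  kernel_weight m (x * a) = x `^ (- (m + 1)) * kernel_weight m a.
Proof.
move=> x0; rewrite /kernel_weight pmulr_rgt0//; case: ifP => a0.
  by rewrite powRM ?ltW.
by rewrite mulr0.
Qed.

Lemma kernel_weight_decr m a x : 0 < m -> 0 < a < x ->
  kernel_weight m x < kernel_weight m a.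
Proof.
move=> m0 /andP[a0 ax]; have x0 : 0 < x by lra.
rewrite /kernel_weight a0 x0 !powRN ltf_pV2 ?posrE ?powR_gt0//.
by rewrite gt0_ltr_powR ?nnegrE ?ltW// ?addr_gt0.
Qed.

(** Near 0 the zero of order 2n+1 of the sine power compensates the weight
    because [m <= 2n]; at infinity boundedness suffices because [1 < m].  The
    function 2 / (1 + a ^ 2) dominates in both regimes. *)
Lemma sine_kernel_bound n m a : 1 < m <= n.*2%:R ->
  `|sine_power n a| * kernel_weight m a <=
    if 0 <= a then 2 * (oneDsqr a)^-1 else 0.
Proof.
move=> /andP[m1 mn]; have := oneDsqr_ge1 a; rewrite /oneDsqr => oD.
rewrite /kernel_weight; case: ifP => a0; last first.
  by rewrite mulr0; case: ifP => // _; rewrite mulr_ge0// invr_ge0; lra.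
rewrite (ltW a0) ler_pdivlMr; last lra.
have [a1|a1] := leP a 1.
  suff: `|sine_power n a| * a `^ (- (m + 1)) <= 1 by nra.
  apply: (@le_trans _ _ (a ^+ n.*2.+1 * a `^ (- (m + 1)))).
    rewrite ler_wpM2r ?powR_ge0// normrX lerXn2r ?nnegrE ?(ltW a0)//.
    by rewrite -[leRHS]gtr0_norm// normr_sin_le.
  rewrite -powR_mulrn ?(ltW a0)// -powRD; last by rewrite (gt_eqF a0) implybT.
  rewrite -[leRHS](powRr0 a) ger_powR ?a0// -natr1; lra.
have B : a `^ (- (m + 1)) <= (a ^+ 2)^-1.
  rewrite -powR_invn ?(ltW a0)// ler_powR ?(ltW a1)//; lra.
apply: (@le_trans _ _ ((a ^+ 2)^-1 * (1 + a ^+ 2))).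
  rewrite ler_wpM2r//; first lra.
  rewrite (le_trans _ B)// ler_piMl ?powR_ge0//.
  exact: normr_sine_power_le1.
have a21 : 1 <= a ^+ 2 by rewrite expr_ge1// ltW.
by rewrite mulrDr mulr1 mulVf ?lerD2r ?invf_le1; lra.
Qed.

Lemma rintegrable_sine_kernel n m : 1 < m <= n.*2%:R ->
  rintegrable mu (fun a => sine_power n a * kernel_weight m a).
Proof.
move=> mn; pose g a := if 0 <= a then 2 * (oneDsqr a)^-1 else 0.
apply: (@le_rintegrable _ _ _ mu _ g).
- by apply: measurable_funM; [exact: measurable_sine_power|
    exact: measurable_kernel_weight].
- move=> a; rewrite normrM [`|kernel_weight _ _|]ger0_norm ?kernel_weight_ge0//.
  exact: sine_kernel_bound.
have -> : g = ((fun a => 2 * (oneDsqr a)^-1) \_ `[0, +oo[%classic).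
  by apply/funext => a; rewrite /g patchE mem_setE in_itv/= andbT.
have iD : mu.-integrable `[0, +oo[%classic (fun a => (oneDsqr a)^-1%:E).
  have mo : measurable_fun setT (fun a : R => (oneDsqr a)^-1).
    by apply: continuous_measurable_fun; exact: continuous_oneDsqrV.
  apply/integrableP; split; first by apply/measurable_EFinP; exact: measurable_funTS.
  under eq_integral do rewrite /= ger0_norm ?invr_ge0 ?(le_trans ler01)//.
  by rewrite integral0y_oneDsqr ltry.
rewrite -restrict_EFin; apply: (integrable_mkcond _ _).1 => //.
exact: (integrableZl _ 2 iD).
Qed.

(** The weight is homogeneous of degree -(m+1), so the substitution a -> x a
    makes the transform homogeneous of degree [m] in [x]. *)
Lemma kernel_weight_scaling (h : R -> R) m x : 0 < x ->
  rintegrable mu (fun a => h a * kernel_weight m a) ->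
  rintegrable mu (fun a => h (a * x) * kernel_weight m a) /\
  \int[mu]_a (h (a * x) * kernel_weight m a) =
    x `^ m * \int[mu]_a (h a * kernel_weight m a).
Proof.
move=> x0 inth.
have xm : x * x `^ m = x `^ (m + 1).
  by rewrite -[x in x * _]powRr1 ?(ltW x0)// -powRD ?(gt_eqF x0) ?implybT// addrC.
have inthx : rintegrable mu (fun a => h (a * x) * kernel_weight m a).
  have /(rintegrableZl (x `^ (m + 1))) := rintegrable_affine 0 x0 inth.
  apply: eq_rintegrable => a; rewrite addr0 kernel_weightM// powRN [x * a]mulrC.
  by field; rewrite gt_eqF// powR_gt0.
split=> //; rewrite (Rintegral_affine 0 x0 inth).
under [in RHS]eq_Rintegral => a _.
  rewrite addr0 kernel_weightM// [x * a]mulrC mulrCA.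
  over.
rewrite RintegralZl// powRN -xm; field.
by rewrite !gt_eqF ?powR_gt0.
Qed.

Lemma sine_power0 n : sine_power n 0 = 0.
Proof. by rewrite /sine_power sin0 expr0n. Qed.

Lemma sine_transform n m x : 1 < m <= n.*2%:R ->
  rintegrable mu (fun a => sine_power n (a * x) * kernel_weight m a) /\
  \int[mu]_a (sine_power n (a * x) * kernel_weight m a) =
    odd_power m x * \int[mu]_a (sine_power n a * kernel_weight m a).
Proof.
move=> mn; have m0 : m != 0 by have /andP[m1 _] := mn; lra.
have intk := rintegrable_sine_kernel mn.
have [x0|x0|->] := ltgtP x 0; last first.
- under eq_Rintegral do rewrite mulr0 sine_power0 mul0r.
  rewrite odd_power0 mul0r /Rintegral integral0; split => //.
  rewrite (_ : (fun _ => _) = cst 0); first exact: integrable0.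
  by apply/funext => a; rewrite mulr0 sine_power0 mul0r.
- by rewrite (ge0_odd_power m0 (ltW x0)); exact: kernel_weight_scaling.
- have /(kernel_weight_scaling (h := sine_power n))/(_ intk) : 0 < - x by lra.
  rewrite -[x in odd_power _ x]opprK odd_powerN ge0_odd_power//; last lra.
  move=> [inth E]; rewrite mulNr -E; split.
    apply: eq_rintegrable (rintegrableZl (-1) inth) => a.
    by rewrite mulrN sine_powerN; ring.
  rewrite -mulN1r -RintegralZl//.
  by apply: eq_Rintegral => a _; rewrite mulrN sine_powerN; ring.
Qed.

(** The absolute version provides the integrability that Fubini asks for. *)
Lemma abs_sine_transform n m x : 1 < m <= n.*2%:R ->
  rintegrable mu (fun a => `|sine_power n (a * x)| * kernel_weight m a) /\
  \int[mu]_a (`|sine_power n (a * x)| * kernel_weight m a) =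
    `|x| `^ m * \int[mu]_a (`|sine_power n a| * kernel_weight m a).
Proof.
move=> mn; have m0 : m != 0 by have /andP[m1 _] := mn; lra.
have intk : rintegrable mu (fun a => `|sine_power n a| * kernel_weight m a).
  apply: eq_rintegrable (rintegrable_norm (rintegrable_sine_kernel mn)) => a.
  by rewrite normrM [`|kernel_weight _ _|]ger0_norm ?kernel_weight_ge0.
have E a : `|sine_power n (a * x)| = `|sine_power n (a * `|x|)|.
  by case: (ger0P x) => // _; rewrite mulrN sine_powerN normrN.
have [->|x0] := eqVneq x 0.
  under eq_Rintegral do rewrite mulr0 sine_power0 normr0 mul0r.
  rewrite normr0 powR0// mul0r /Rintegral integral0; split => //.
  rewrite (_ : (fun _ => _) = cst 0); first exact: integrable0.
  by apply/funext => a; rewrite mulr0 sine_power0 normr0 mul0r.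
rewrite (_ : (fun a => _) =
  fun a => `|sine_power n (a * `|x|)| * kernel_weight m a); last first.
  by apply/funext => a; rewrite E.
by apply: (kernel_weight_scaling (h := fun a => `|sine_power n a|)) => //;
  rewrite normr_gt0.
Qed.

(** The sine power changes sign under a shift by pi while the weight
    decreases, so each negative arch is outweighed by the positive arch that
    precedes it.  With [p] and [q] the positive and negative parts,
    q (a + pi) = p a, and the integral becomes that of
    p a * (w a - w (a + pi)), which is nonnegative, and positive on ]0, pi[. *)
Lemma sine_transform_const_neq0 n m : 1 < m <= n.*2%:R ->
  \int[mu]_a (sine_power n a * kernel_weight m a) != 0.
Proof.
move=> mn; have intk := rintegrable_sine_kernel mn.
have m0 : 0 < m by have /andP[m1 _] := mn; lra.
pose p a := Num.max (sine_power n a) 0.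
pose q a := Num.max (- sine_power n a) 0.
pose w := kernel_weight m.
pose J a := p a * (w a - w (a + pi)).
have w0 a : 0 <= w a by exact: kernel_weight_ge0.
have mp : measurable_fun setT p.
  by apply: measurable_maxr => //; exact: measurable_sine_power.
have mq : measurable_fun setT q.
  by apply: measurable_maxr => //; apply: measurable_funN; exact: measurable_sine_power.
have mw : measurable_fun setT w by exact: measurable_kernel_weight.
have intpw : rintegrable mu (fun a => p a * w a).
  apply: le_rintegrable (rintegrable_norm intk); first exact: measurable_funM.
  move=> a; rewrite !normrM ler_wpM2r// /p.
  by case: (leP (sine_power n a) 0); rewrite ?normr0.
have intqw : rintegrable mu (fun a => q a * w a).
  apply: le_rintegrable (rintegrable_norm intk); first exact: measurable_funM.
  move=> a; rewrite !normrM ler_wpM2r// /q.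
  by case: (leP (- sine_power n a) 0); rewrite ?normr0// normrN.
have qpi a : q (a + pi) = p a.
  by rewrite /q /p /sine_power sinDpi exprNn -signr_odd/= odd_double mulN1r opprK.
have intpw' := rintegrable_affine pi ltr01 intqw.
have -> : \int[mu]_a (sine_power n a * kernel_weight m a) = \int[mu]_a J a.
  transitivity (\int[mu]_a (p a * w a - q a * w a)).
    apply: eq_Rintegral => a _; rewrite -mulrBl; congr (_ * _).
    by rewrite /p /q; case: leP => h1; case: leP => h2; lra.
  rewrite RintegralB// (Rintegral_affine pi ltr01 intqw) mul1r -RintegralB//.
  by apply: eq_Rintegral => a _; rewrite mul1r qpi /J mulrBr.
have p0 a : 0 <= p a by rewrite /p le_max lexx orbT.
have pi0 := @pi_gt0 R.
have J0 a : 0 <= J a.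
  have [a0|a0] := ltP 0 a.
    by rewrite mulr_ge0// subr_ge0 ltW// kernel_weight_decr// a0 ltrDl.
  have [api|api] := leP a (- pi).
    by rewrite /J [w (a + pi)]/w /kernel_weight ltNge -lerBrDr sub0r api subr0 mulr_ge0.
  rewrite /J (_ : p a = 0) ?mul0r// /p max_r// -[a]opprK sine_powerN oppr_le0.
  by rewrite exprn_ge0// sin_ge0_pi//; lra.
have Jgt0 a : 0 < a < pi -> 0 < J a.
  move=> /andP[a0 api]; rewrite mulr_gt0//.
    by rewrite /p lt_max exprn_gt0// sin_gt0_pi// a0.
  by rewrite subr_gt0 kernel_weight_decr// a0 ltrDl.
have intJ : rintegrable mu J.
  apply: eq_rintegrable (rintegrableB intpw intpw') => a.
  by rewrite mul1r qpi /J mulrBr.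
apply/eqP => J00.
have : (\int[mu]_a `|(J a)%:E| = 0)%E.
  under eq_integral do rewrite abse_EFin ger0_norm//.
  by rewrite -EFin_Rintegral// J00.
move/ae_eq_integral_abs => /(_ measurableT (measurable_int _ intJ)).
move=> [N [mN N0 JN]].
have : (mu `]0%R, pi[%classic <= mu N)%E.
  apply: le_measure; rewrite ?inE//=.
  move=> a /=; rewrite in_itv/= => a0; apply: JN => /=.
  by move=> /(_ I) [] Ja; have := Jgt0 _ a0; rewrite Ja ltxx.
by rewrite N0 lebesgue_measure_itv/= lte_fin pi_gt0 -EFinB lee_fin subr0 leNgt pi_gt0.
Qed.

End sine_transform.

(** * Centered normal laws *)

Section integral_density.
Context d (T : measurableType d) (R : realType).
Variables (mu nu : {measure set T -> \bar R}) (g : T -> R).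
Hypotheses (mg : measurable_fun setT g) (g0 : forall x, 0 <= g x).
Hypothesis nuE : forall A, measurable A -> nu A = (\int[mu]_(x in A) (g x)%:E)%E.
Local Open Scope ereal_scope.

Import HBNNSimple.

Lemma ge0_integral_density (f : T -> \bar R) :
  measurable_fun setT f -> (forall x, 0 <= f x) ->
  \int[nu]_x f x = \int[mu]_x (f x * (g x)%:E).
Proof.
move=> mf f0; pose f_ := nnsfun_approx measurableT mf.
have f_cvg x : EFin \o f_^~ x @ \oo --> f x by exact: cvg_nnsfun_approx.
transitivity (limn (fun n => \int[nu]_x (f_ n x)%:E)).
  rewrite -monotone_convergence//.
  - by apply: eq_integral => x _; apply/esym/cvg_lim => //; exact: f_cvg.
  - by move=> n; exact/measurable_EFinP/measurable_funP.
  - by move=> n x _; rewrite lee_fin.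
  - by move=> x _ i j ij; rewrite lee_fin; exact/lefP/nd_nnsfun_approx.
rewrite (_ : (fun n => _) =
    (fun n => \int[mu]_x ((f_ n x)%:E * (g x)%:E))); last first.
  apply/funext => n.
  transitivity (\sum_(k \in range (f_ n))
      \int[nu]_x (k * \1_(f_ n @^-1` [set k]) x)%:E).
    under eq_integral do rewrite fimfunE -fsumEFin//.
    rewrite ge0_integral_fsum//.
    - by move=> y; exact/measurable_EFinP/measurable_funM.
    - by move=> y x _; rewrite nnfun_muleindic_ge0.
  transitivity (\sum_(k \in range (f_ n))
      \int[mu]_x ((k * \1_(f_ n @^-1` [set k]) x)%:E * (g x)%:E)); last first.
    rewrite -ge0_integral_fsum//.
    - apply: eq_integral => x _; rewrite -ge0_mule_fsuml; last first.
        by move=> k; rewrite nnfun_muleindic_ge0.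
      by rewrite fsumEFin// -fimfunE.
    - by move=> y; apply: emeasurable_funM; apply/measurable_EFinP => //;
        exact: measurable_funM.
    - move=> y x _; apply: mule_ge0; last by rewrite lee_fin.
      by rewrite EFinM nnfun_muleindic_ge0.
  apply: eq_fsbigr => k _; rewrite integralZl_indic_nnsfun// integral_indic// setIT.
  have [k0|k0] := ltP k 0%R.
    rewrite preimage_nnfun0// measure0 mule0 integral0_eq// => x _.
    by rewrite indic0 mulr0 mul0e.
  under eq_integral do rewrite EFinM -muleA.
  rewrite ge0_integralZl//; last 2 first.
  - by apply: emeasurable_funM; apply/measurable_EFinP.
  - by move=> x _; rewrite mule_ge0// lee_fin.
  rewrite nuE//; congr (_ * _).
  rewrite integral_mkcond; apply: eq_integral => x _.
  by rewrite patchE indicE; case: ifPn => _; rewrite ?mul1e ?mul0e.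
rewrite -monotone_convergence//.
- apply: eq_integral => x _; apply/cvg_lim => //.
  by apply: cvgeZr => //; exact: f_cvg.
- by move=> n; apply: emeasurable_funM; apply/measurable_EFinP.
- by move=> n x _; rewrite mule_ge0 ?lee_fin.
- move=> x _ i j ij; rewrite lee_wpmul2r ?lee_fin//.
  exact/lefP/nd_nnsfun_approx.
Qed.

End integral_density.

Section normal_law.
Variable R : realType.
Notation mu := (@lebesgue_measure R).
Notation gamma := (@normal_prob R 0 1).
Implicit Types (p s x : R).

Lemma normal_pdf_scale s x : s != 0 ->
  `|s| * normal_pdf 0 s (`|s| * x) = normal_pdf 0 1 x.
Proof.
move=> s0; have s'0 : 0 < `|s| by rewrite normr_gt0.
rewrite !normal_pdfE// /normal_peak /normal_fun !subr0 mulrA; congr (_ * expR _).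
  rewrite expr1n mul1r -mulrnAr sqrtrM ?sqr_ge0// sqrtr_sqr -mulr_natl.
  by rewrite mulr_natl invfM mulrA divff// ?gt_eqF// mul1r.
rewrite exprMn expr1n -[s ^+ 2]real_normK ?num_real//; field.
by rewrite gt_eqF.
Qed.

(** N(0, s ^ 2) is the image of N(0, 1) under scaling by |s|; stated in this way
    the point mass at [s = 0] is no longer exceptional. *)
Lemma centered_normalE s (A : set R) : measurable A ->
  centered_normal s A = gamma ((fun x => `|s| * x) @^-1` A).
Proof.
move=> mA; rewrite /centered_normal; case: ifPn => [/eqP ->|s0].
  rewrite (_ : (fun x => `|0| * x) = cst 0); last first.
    by apply/funext => x; rewrite normr0 mul0r.
  rewrite preimage_cst diracE; case: ifPn => _; last by rewrite measure0.
  by rewrite probability_setT.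
have s'0 : 0 < `|s| by rewrite normr_gt0.
have mgs : measurable_fun setT (fun x : R => `|s| * x) by exact: measurable_funM.
have mpdf : measurable_fun setT ((fun x => (normal_pdf 0 s x)%:E) \_ A).
  apply: (measurable_restrictT _ mA).1; apply/measurable_EFinP.
  by apply: measurable_funTS; exact: measurable_normal_pdf.
have pdf0 x : (0 <= ((fun x => (normal_pdf 0 s x)%:E) \_ A) x)%E.
  by rewrite patchE; case: ifP => // _; rewrite lee_fin normal_pdf_ge0.
rewrite {1}/normal_prob integral_mkcond (ge0_integral_affine 0 s'0)//.
rewrite -ge0_integralZl_EFin//; last first.
  apply: (measurableT_comp mpdf); by apply: measurable_funD.
rewrite /normal_prob [RHS]integral_mkcond; apply: eq_integral => x _.
rewrite addr0 !patchE.
have -> : (x \in (fun x => `|s| * x) @^-1` A) = (`|s| * x \in A).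
  by apply/idP/idP; rewrite !inE.
case: ifP => _; last by rewrite mule0.
by rewrite -EFinM normal_pdf_scale.
Qed.

Section moments.
Context d (Omega : measurableType d) (P : probability Omega R).
Variables (Y : Omega -> R) (s : R).
Hypothesis Ys : has_centered_normal_law P Y s.

Lemma ge0_integral_normal_law (f : R -> \bar R) :
  measurable_fun setT f -> (forall x, 0 <= f x)%E ->
  (\int[P]_w f (Y w) = \int[gamma]_x f (`|s| * x)%R)%E.
Proof.
move=> mf f0; have [mY PY] := Ys.
have mgs : measurable_fun setT (fun x : R => `|s| * x) by exact: measurable_funM.
transitivity (\int[P]_(w in Y @^-1` setT) (f \o Y) w)%E.
  by rewrite preimage_setT.
rewrite -ge0_integral_pushforward//.
transitivity (\int[gamma]_(w in (fun x => `|s| * x)%R @^-1` setT)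
    (f \o (fun x => `|s| * x)%R) w)%E; last by rewrite preimage_setT.
rewrite -ge0_integral_pushforward//.
apply: eq_measure_integral => A mA _.
transitivity (P (Y @^-1` A)); first by [].
by rewrite PY// centered_normalE.
Qed.

End moments.

(** The rate 3/8 = 1/2 - 1/8 is the gap between the exponents of the densities
    of N(0, 1) and N(0, 4), which lets the latter absorb any power. *)
Lemma powR_le_expR p : 0 <= p ->
  exists2 C, 0 < C & forall x, `|x| `^ p <= C * expR (3 / 8 * x ^+ 2).
Proof.
move=> p0; pose N := (Num.truncn p).+1.
have pN : p <= N.*2%:R by rewrite -muln2 natrM; have := truncnS_gt p; rewrite -/N; lra.
pose c : R := 8 / 3; pose C : R := c ^+ N * N`!%:R.
have c1 : 1 <= c by rewrite /c; lra.
have cN : 1 <= c ^+ N by exact: exprn_ege1.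
have f1 : (1 : R) <= N`!%:R by rewrite ler1n fact_gt0.
have C1 : 1 <= C by rewrite /C; nra.
exists C => [|x]; first lra.
have y0 : 0 <= 3 / 8 * x ^+ 2 by rewrite mulr_ge0// sqr_ge0.
apply: le_trans (_ : C * (1 + (3 / 8 * x ^+ 2) ^+ N / N`!%:R) <= _); last first.
  by rewrite ler_pM2l ?expR_ge1Dxn//; lra.
have CE : C * ((3 / 8 * x ^+ 2) ^+ N / N`!%:R) = `|x| ^+ N.*2.
  rewrite /C [_ ^+ N / _]mulrC mulrA mulfK ?pnatr_eq0 -?lt0n ?fact_gt0//.
  rewrite -exprMn -mul2n exprM real_normK ?num_real//; congr (_ ^+ N).
  by rewrite /c; field.
rewrite mulrDr mulr1 CE.
have [x1|x1] := leP `|x| 1.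
  apply: le_trans (_ : 1 <= _); last by rewrite (le_trans C1)// lerDl exprn_ge0.
  have <- : (1 : R) `^ p = 1 by rewrite powR1.
  by rewrite ge0_ler_powR ?nnegrE.
apply: le_trans (_ : `|x| ^+ N.*2 <= _); last by rewrite lerDr; lra.
by rewrite -powR_mulrn// ler_powR// ltW.
Qed.

Lemma rintegrable_normal_moment p : 0 <= p -> rintegrable gamma (fun x => `|x| `^ p).
Proof.
move=> p0.
have mp : measurable_fun setT (fun x : R => `|x| `^ p).
  by apply: (@measurableT_comp _ _ _ _ _ _ (@powR R ^~ p)).
apply/ge0_rintegrableP => //.
rewrite (@ge0_integral_density _ _ _ mu gamma (normal_pdf 0 1))//; last 3 first.
- exact: measurable_normal_pdf.
- by move=> x; exact: normal_pdf_ge0.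
- exact/measurable_EFinP.
(* The standard density times the power is dominated by a multiple of the
   density of standard deviation 2. *)
have [C C0 pC] := powR_le_expR p0.
have n1 : (1 : R) != 0 by [].
have n2 : (2 : R) != 0 by [].
have [k1 k2] := (normal_peak_gt0 n1, normal_peak_gt0 n2).
pose K := C * normal_peak 1 / normal_peak (2 : R).
have iK : rintegrable mu (fun x => K * normal_pdf 0 2 x).
  by apply: rintegrableZl; exact: integrable_normal_pdf.
have mpdf : measurable_fun setT (@normal_pdf R 0 1) by exact: measurable_normal_pdf.
have bd x : `|x| `^ p * normal_pdf 0 1 x <= K * normal_pdf 0 2 x.
  rewrite !normal_pdfE// /normal_fun !subr0.
  rewrite (_ : K * _ = C * normal_peak 1 * expR (- x ^+ 2 / (2 ^+ 2 *+ 2))); last first.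
    by rewrite /K; field; rewrite gt_eqF.
  rewrite (_ : - x ^+ 2 / (2 ^+ 2 *+ 2) =
    3 / 8 * x ^+ 2 + - x ^+ 2 / (1 ^+ 2 *+ 2)); last by field.
  rewrite expRD; have := pC x; have := expR_gt0 (- x ^+ 2 / (1 ^+ 2 *+ 2)).
  move: (expR _) (expR _) => e1 e2 e10 h.
  rewrite mulrCA [C * _]mulrC -!mulrA ler_pM2l// mulrA ler_pM2r//.
have mM : measurable_fun setT (fun x => `|x| `^ p * normal_pdf 0 1 x).
  exact: measurable_funM.
have b0 x : 0 <= `|x| `^ p * normal_pdf 0 1 x.
  by rewrite mulr_ge0 ?powR_ge0 ?normal_pdf_ge0.
apply: (ge0_rintegrableP mu mM b0).1.
apply: le_rintegrable iK => // x; by rewrite ger0_norm.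
Qed.

Definition normal_moment p : R := \int[gamma]_x (`|x| `^ p).

Lemma normal_moment2_gt0 : 0 < normal_moment 2.
Proof.
have i2 : rintegrable gamma (fun x => `|x| `^ 2) by exact: rintegrable_normal_moment.
rewrite lt_neqAle Rintegral_ge0 ?andbT; last by move=> x _; rewrite powR_ge0.
rewrite eq_sym; apply/eqP => M0.
have : (\int[gamma]_x `|(`|x| `^ 2)%:E| = 0)%E.
  under eq_integral do rewrite abse_EFin ger0_norm ?powR_ge0//.
  by rewrite -EFin_Rintegral// -/(normal_moment 2) M0.
move/ae_eq_integral_abs => /(_ measurableT (measurable_int _ i2)).
move=> [N [mN N0 JN]].
have g0 : gamma [set 0 : R] = 0%E.
  by rewrite /normal_prob integral_set1.
have : (gamma setT <= gamma (N `|` [set 0%R]))%E.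
  apply: le_measure; rewrite ?inE//=; first exact: measurableU.
  move=> x _; have [->|x0] := eqVneq x 0; [by right|left; apply: JN => /=].
  move=> /(_ I) [] /eqP; rewrite powR_eq0 normr_eq0 (negbTE x0)//.
rewrite leNgt => /negP; apply.
apply: le_lt_trans (measureU2 _ _ _) _ => //.
have {}N0 : gamma N = 0%E := N0.
change (gamma N + gamma [set 0%R] < gamma setT)%E.
by rewrite N0 g0 adde0 probability_setT lte01.
Qed.

(** The moment of order [p] of a centered normal variable of variance 1; dividing
    by the second moment spares the computation of that moment. *)
Definition moment_const p : R := normal_moment p / normal_moment 2 `^ (p / 2).

Section law_moments.
Context d (Omega : measurableType d) (P : probability Omega R).
Implicit Types Y : Omega -> R.

Lemma normal_law_moment Y s p : has_centered_normal_law P Y s -> 0 <= p ->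
  rintegrable P (fun w => `|Y w| `^ p) /\
  \int[P]_w (`|Y w| `^ p) = `|s| `^ p * normal_moment p.
Proof.
move=> Ys p0; have mY := Ys.1.
have mp : measurable_fun setT (fun x : R => `|x| `^ p).
  by apply: (@measurableT_comp _ _ _ _ _ _ (@powR R ^~ p)).
have Mp := rintegrable_normal_moment p0.
have E : (\int[P]_w (`|Y w| `^ p)%:E = (`|s| `^ p * normal_moment p)%:E)%E.
  rewrite (ge0_integral_normal_law Ys (f := fun x => (`|x| `^ p)%:E)); last 2 first.
  - exact/measurable_EFinP.
  - by move=> x; rewrite lee_fin powR_ge0.
  rewrite EFinM EFin_Rintegral// -ge0_integralZl_EFin ?powR_ge0//; last exact/measurable_EFinP.
  by apply: eq_integral => x _; rewrite normrM normr_id powRM.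
split; last by rewrite /Rintegral E.
apply/ge0_rintegrableP; rewrite ?E ?ltry//.
exact: (measurableT_comp mp).
Qed.

Lemma rintegrable_normal_sqr Y s : has_centered_normal_law P Y s ->
  rintegrable P (fun w => Y w ^+ 2).
Proof.
move=> /normal_law_moment/(_ (ler0n _ 2))[+ _]; apply: eq_rintegrable => w.
by rewrite powR_mulrn// real_normK ?num_real.
Qed.

Lemma normal_law_variance Y s : has_centered_normal_law P Y s ->
  \int[P]_w (Y w ^+ 2) = s ^+ 2 * normal_moment 2.
Proof.
move=> /normal_law_moment/(_ (ler0n _ 2))[_].
rewrite powR_mulrn// real_normK ?num_real// => <-.
by apply: eq_Rintegral => w _; rewrite powR_mulrn// real_normK ?num_real.
Qed.

Lemma normal_law_momentE Y s p : has_centered_normal_law P Y s -> 0 <= p ->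
  \int[P]_w (`|Y w| `^ p) = moment_const p * (\int[P]_w (Y w ^+ 2)) `^ (p / 2).
Proof.
move=> Ys p0; rewrite (normal_law_moment Ys p0).2 (normal_law_variance Ys).
have M2 := normal_moment2_gt0.
rewrite powRM ?sqr_ge0 ?(ltW M2)// -[s ^+ 2]real_normK ?num_real// -powR_mulrn//.
rewrite -powRrM [2 * _]mulrC divfK// /moment_const; field.
by rewrite gt_eqF ?powR_gt0.
Qed.

Lemma moment_const_ge0 p : 0 <= moment_const p.
Proof.
by rewrite divr_ge0 ?powR_ge0// Rintegral_ge0// => x _; rewrite powR_ge0.
Qed.

(** A centered normal law is determined by its variance; nonnegative test
    functions are enough for the use made of it with 1 + cos. *)
Lemma ge0_normal_law_eq Y Y' s s' (f : R -> \bar R) :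
  has_centered_normal_law P Y s -> has_centered_normal_law P Y' s' ->
  \int[P]_w (Y w ^+ 2) = \int[P]_w (Y' w ^+ 2) ->
  measurable_fun setT f -> (forall x, 0 <= f x)%E ->
  (\int[P]_w f (Y w) = \int[P]_w f (Y' w))%E.
Proof.
move=> Ys Ys' E mf f0.
rewrite (ge0_integral_normal_law Ys)// (ge0_integral_normal_law Ys')//.
suff -> : `|s| = `|s'| by [].
have M2 := normal_moment2_gt0.
move: E; rewrite (normal_law_variance Ys) (normal_law_variance Ys').
move/(mulIf (lt0r_neq0 M2)) => /(congr1 Num.sqrt).
by rewrite !sqrtr_sqr.
Qed.

End law_moments.

End normal_law.

(** * Orthogonality: from sines to odd powers *)

Section bounded_integrable.
Context d (Omega : measurableType d) (R : realType) (P : probability Omega R).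

Lemma bounded_rintegrable (M : R) (f : Omega -> R) :
  measurable_fun setT f -> (forall w, `|f w| <= M) -> rintegrable P f.
Proof.
move=> mf fM; apply: (@le_rintegrable _ _ _ P _ (cst M)) => //.
exact: finite_measure_integrable_cst.
Qed.

Lemma bounded_rintegrableM (M : R) (f g : Omega -> R) :
  measurable_fun setT f -> (forall w, `|f w| <= M) ->
  rintegrable P g -> rintegrable P (fun w => f w * g w).
Proof.
move=> mf fM intg.
apply: le_rintegrable (rintegrableZl M (rintegrable_norm intg)).
  by apply: measurable_funM => //; exact: rintegrable_measurable intg.
by move=> w; rewrite normrM ler_wpM2r.
Qed.

End bounded_integrable.

Section sine_orthogonality.
Context d (Omega : measurableType d) (R : realType) (P : probability Omega R).
Implicit Types (U V G : Omega -> R) (m a b : R).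

Lemma measurable_sinM a U : measurable_fun setT U ->
  measurable_fun setT (fun w => sin (a * U w)).
Proof.
move=> mU; apply: (@measurableT_comp _ _ _ _ _ _ (@sin R)).
  by apply: continuous_measurable_fun; exact: continuous_sin.
exact: measurable_funM.
Qed.

(** Induction on the power by the product formula
    sin (a x) sin x ^ 2 =
      sin (a x) / 2 - (sin ((a + 2) x) + sin ((a - 2) x)) / 4,
    which is why all frequencies [a] are carried along. *)
Lemma sine_power_orthogonal n U G : measurable_fun setT U -> rintegrable P G ->
  (forall a, \int[P]_w (sin (a * U w) * G w) = 0) ->
  \int[P]_w (sine_power n (U w) * G w) = 0.
Proof.
move=> mU intG orth.
have intS i a : rintegrable P (fun w => sin (a * U w) * (sin (U w) ^+ i * G w)).
  apply: (bounded_rintegrableM (M := 1)).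
  - exact: measurable_sinM.
  - by move=> w; exact: sin_max.
  - apply: (bounded_rintegrableM (M := 1)) => //.
      apply: measurable_funX.
      by have := measurable_sinM 1 mU; under eq_fun do rewrite mul1r.
    by move=> w; rewrite normrX exprn_ile1// sin_max.
suff /(_ n 1) : forall i a,
    \int[P]_w (sin (a * U w) * (sin (U w) ^+ i.*2 * G w)) = 0.
  move=> <-; apply: eq_Rintegral => w _.
  by rewrite /sine_power mul1r exprS mulrA.
elim=> [|i IHi] a.
  by rewrite -(orth a); apply: eq_Rintegral => w _; rewrite expr0 mul1r.
pose F c w := sin (c * U w) * (sin (U w) ^+ i.*2 * G w).
transitivity (\int[P]_w (2^-1 * F a w - 4^-1 * (F (a + 2) w + F (a - 2) w))).
  apply: eq_Rintegral => w _; rewrite /F doubleS !exprS.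
  rewrite (mulrDl a) (mulrBl _ a) sinD sinB mulr_natl cos_mulr2n cos2sin2.
  by field.
have intF c : rintegrable P (F c) by exact: intS.
rewrite RintegralB//; last 2 first.
- exact: rintegrableZl.
- by apply: rintegrableZl; exact: rintegrableD.
rewrite !RintegralZl//; last exact: rintegrableD.
by rewrite RintegralD// !IHi; ring.
Qed.

(** Integrate the hypothesis over the dilation [a] against the weight
    [kernel_weight m]: by [sine_transform] and Fubini this gives a nonzero multiple
    of the conclusion. *)
Lemma odd_power_of_sine_orthogonal m U V : 1 < m ->
  measurable_fun setT U -> rintegrable P V ->
  rintegrable P (fun w => `|U w| `^ m * V w) ->
  (forall n a, \int[P]_w (sine_power n (a * U w) * V w) = 0) ->
  \int[P]_w (odd_power m (U w) * V w) = 0.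
Proof.
move=> m1 mU intV intUV orth; have mV := rintegrable_measurable intV.
pose n := (Num.truncn m).+1.
have mn : 1 < m <= n.*2%:R.
  by rewrite m1 -muln2 natrM; have := truncnS_gt m; rewrite -/n; lra.
pose C := \int[lebesgue_measure]_a (sine_power n a * kernel_weight m a).
pose C' := \int[lebesgue_measure]_a (`|sine_power n a| * kernel_weight m a).
pose A (w : Omega) (a : R) := sine_power n (a * U w) * kernel_weight m a * V w.
have mA : measurable_fun setT (fun z : Omega * R => A z.1 z.2).
  have m1' (f : Omega -> R) : measurable_fun setT f ->
      measurable_fun setT (fun z : Omega * R => f z.1).
    by move=> mf; exact: measurableT_comp.
  apply: measurable_funM; last exact: m1'.
  apply: measurable_funM.
    apply: (measurableT_comp (measurable_sine_power n)).
    by apply: measurable_funM => //; exact: m1'.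
  exact: (measurableT_comp (measurable_kernel_weight m)).
have absA w : (\int[lebesgue_measure]_a `|A w a|%:E)%E =
    (C' * `| `|U w| `^ m * V w|)%:E.
  have [intA EA] := abs_sine_transform (U w) mn.
  transitivity (\int[lebesgue_measure]_a
      (`|V w|%:E * (`|sine_power n (a * U w)| * kernel_weight m a)%:E))%E.
    apply: eq_integral => a _.
    by rewrite -EFinM /A !normrM (ger0_norm (kernel_weight_ge0 m a)) mulrC.
  rewrite ge0_integralZl_EFin//; last 2 first.
  - by move=> a _; rewrite lee_fin mulr_ge0// kernel_weight_ge0.
  - exact: measurable_int intA.
  rewrite -EFin_Rintegral// EA -EFinM; congr (_%:E).
  by rewrite normrM (ger0_norm (powR_ge0 _ _)) -/C'; ring.
have Aoo : (\int[P]_w \int[lebesgue_measure]_a `|A w a|%:E < +oo)%E.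
  under eq_integral do rewrite absA.
  have iV := rintegrableZl C' (rintegrable_norm intUV).
  by rewrite -(EFin_Rintegral iV) ltry.
have [_ _ FA] := Rintegral_Fubini (m1 := P) (m2 := lebesgue_measure) mA Aoo.
have inA w : \int[lebesgue_measure]_a A w a = C * (odd_power m (U w) * V w).
  have [intA EA] := sine_transform (U w) mn.
  by rewrite RintegralZr// EA -/C; ring.
have outA a : \int[P]_w A w a = 0.
  transitivity (\int[P]_w (kernel_weight m a * (sine_power n (a * U w) * V w))).
    by apply: eq_Rintegral => w _; rewrite /A; ring.
  rewrite RintegralZl ?orth ?mulr0//.
  apply: (bounded_rintegrableM (M := 1)) => //.
    apply: (measurableT_comp (measurable_sine_power n)).
    exact: measurable_funM.
  by move=> w; exact: normr_sine_power_le1.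
have C0 : C != 0 by exact: sine_transform_const_neq0.
apply: (mulfI C0); rewrite mulr0 -RintegralZl//; last first.
  apply: le_rintegrable (rintegrable_norm intUV).
    apply: measurable_funM => //.
    exact: (measurableT_comp (measurable_odd_power m)).
  move=> w; rewrite normrM normr_odd_power; last lra.
  by rewrite normrM (ger0_norm (powR_ge0 _ _)).
transitivity (\int[P]_w \int[lebesgue_measure]_a A w a).
  by apply: eq_Rintegral => w _; rewrite inA.
rewrite FA; under eq_Rintegral do rewrite outA.
by rewrite /Rintegral integral0.
Qed.

End sine_orthogonality.

(** * Correlation of odd powers of jointly Gaussian variables *)

Section gaussian_pair.
Context d (Omega : measurableType d) (R : realType) (P : probability Omega R).
Implicit Types (Y Z N : Omega -> R) (m a b v rho : R).

Definition gaussian_pair Y Z := forall a b, exists s,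
  has_centered_normal_law P (fun w => a * Y w + b * Z w) s.

Lemma gaussian_pairC Y Z : gaussian_pair Y Z -> gaussian_pair Z Y.
Proof.
move=> YZ a b; have [s h] := YZ b a; exists s.
by under [X in has_centered_normal_law _ X _]eq_fun do rewrite addrC.
Qed.

Lemma gaussian_pair_law Y Z : gaussian_pair Y Z ->
  exists s, has_centered_normal_law P Y s.
Proof.
move=> /(_ 1 0)[s h]; exists s; move: h.
by under [X in has_centered_normal_law _ X _]eq_fun do rewrite mul1r mul0r addr0.
Qed.

Lemma gaussian_pair_measurable Y Z : gaussian_pair Y Z -> measurable_fun setT Y.
Proof. by move=> /gaussian_pair_law[s []]. Qed.

Lemma gaussian_pair_shear Y Z rho : gaussian_pair Y Z ->
  gaussian_pair Y (fun w => Z w - rho * Y w).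
Proof.
move=> YZ a b; have [s h] := YZ (a - b * rho) b; exists s.
rewrite (_ : (fun w => _) = fun w => (a - b * rho) * Y w + b * Z w)//.
by apply/funext => w; ring.
Qed.

Lemma gaussian_pair_rintegrable Y Z p q : gaussian_pair Y Z -> 0 <= p -> 0 <= q ->
  rintegrable P (fun w => `|Y w| `^ p * `|Z w| `^ q).
Proof.
move=> YZ p0 q0; have ZY := gaussian_pairC YZ.
have [[s Ys] [t Zt]] := (gaussian_pair_law YZ, gaussian_pair_law ZY).
have pq0 : 0 <= p + q by exact: addr_ge0.
have [iY _] := normal_law_moment Ys pq0; have [iZ _] := normal_law_moment Zt pq0.
apply: le_rintegrable (rintegrableD iY iZ).
  apply: measurable_funM.
    apply: (@measurableT_comp _ _ _ _ _ _ (@powR R ^~ p)) => //.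
    by apply: measurableT_comp => //; exact: gaussian_pair_measurable YZ.
  apply: (@measurableT_comp _ _ _ _ _ _ (@powR R ^~ q)) => //.
  by apply: measurableT_comp => //; exact: gaussian_pair_measurable ZY.
by move=> w; rewrite ger0_norm ?mulr_ge0 ?powR_ge0// normr_powRM_le.
Qed.

Lemma gaussian_pair_rintegrableM Y Z : gaussian_pair Y Z ->
  rintegrable P (fun w => Y w * Z w).
Proof.
move=> YZ; have ZY := gaussian_pairC YZ.
apply: le_rintegrable (gaussian_pair_rintegrable YZ ler01 ler01).
  apply: measurable_funM; [exact: gaussian_pair_measurable YZ|
    exact: gaussian_pair_measurable ZY].
by move=> w; rewrite normrM !powRr1.
Qed.

Lemma gaussian_pair_sqr Y Z : gaussian_pair Y Z -> rintegrable P (fun w => Y w ^+ 2).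
Proof. by move=> /gaussian_pair_law[s /rintegrable_normal_sqr]. Qed.

Lemma gaussian_pair_variance Y Z a b : gaussian_pair Y Z ->
  \int[P]_w ((a * Y w + b * Z w) ^+ 2) =
  a ^+ 2 * \int[P]_w (Y w ^+ 2) + b ^+ 2 * \int[P]_w (Z w ^+ 2) +
  2 * a * b * \int[P]_w (Y w * Z w).
Proof.
move=> YZ; have ZY := gaussian_pairC YZ.
have [iY iZ] := (gaussian_pair_sqr YZ, gaussian_pair_sqr ZY).
have iYZ := gaussian_pair_rintegrableM YZ.
have [iY' iZ'] := (rintegrableZl (a ^+ 2) iY, rintegrableZl (b ^+ 2) iZ).
have iYZ' := rintegrableZl (2 * a * b) iYZ.
rewrite -!RintegralZl// -RintegralD// -RintegralD//; last exact: rintegrableD.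
by apply: eq_Rintegral => w _; ring.
Qed.

(** The product of the sines is half the difference of the cosines of
    a Y - b N and a Y + b N, two centered normal variables of equal variance.
    The test function 1 + cos keeps the integrands nonnegative. *)
Lemma gaussian_pair_sin Y N a b : gaussian_pair Y N ->
  \int[P]_w (Y w * N w) = 0 ->
  \int[P]_w (sin (a * Y w) * sin (b * N w)) = 0.
Proof.
move=> YN cov0.
have [mY mN] := (gaussian_pair_measurable YN,
  gaussian_pair_measurable (gaussian_pairC YN)).
pose f (x : R) := (1 + cos x)%:E.
have mcos : measurable_fun setT (@cos R).
  by apply: continuous_measurable_fun; exact: continuous_cos.
have mf : measurable_fun setT f.
  by apply/measurable_EFinP; exact: measurable_funD.
have f0 x : (0 <= f x)%E by rewrite lee_fin; have := cos_geN1 x; lra.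
have [[s Ss] [t Tt]] := (YN a b, YN a (- b)).
have icos c : rintegrable P (fun w => cos (a * Y w + c * N w)).
  apply: (@bounded_rintegrable _ _ _ P 1); last by move=> w; exact: cos_max.
  by apply: (measurableT_comp mcos); apply: measurable_funD; exact: measurable_funM.
have i1 : rintegrable P (fun=> 1 : R).
  by apply: (@bounded_rintegrable _ _ _ P 1) => // w; rewrite normr1.
have E : \int[P]_w cos (a * Y w + b * N w) = \int[P]_w cos (a * Y w + - b * N w).
  have := ge0_normal_law_eq Ss Tt _ mf f0.
  rewrite !gaussian_pair_variance// cov0 sqrrN !mulr0 => /(_ erefl).
  rewrite /f -[X in X = _ -> _]EFin_Rintegral -1?[X in _ = X -> _]EFin_Rintegral;
    try exact: rintegrableD.
  by move=> [] ; rewrite !RintegralD// => /addrI.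
transitivity (\int[P]_w (2^-1 *
   (cos (a * Y w + - b * N w) - cos (a * Y w + b * N w)))).
  by apply: eq_Rintegral => w _; rewrite mulNr cosB cosD; field.
by rewrite RintegralZl ?RintegralB ?E ?subrr ?mulr0//; exact: rintegrableB.
Qed.

(** Each of the two factors is passed in turn from sines to sine powers, then
    to the odd power. *)
Lemma gaussian_pair_odd_power_uncorrelated m Y N : 1 < m -> gaussian_pair Y N ->
  \int[P]_w (Y w * N w) = 0 ->
  \int[P]_w (odd_power m (Y w) * odd_power m (N w)) = 0.
Proof.
move=> m1 YN cov0; have NY := gaussian_pairC YN.
have [mY mN] := (gaussian_pair_measurable YN, gaussian_pair_measurable NY).
have m0 : 0 <= m by lra.
have mm (U : Omega -> R) : measurable_fun setT U ->
    measurable_fun setT (fun w => `|U w| `^ m).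
  move=> mU; apply: (@measurableT_comp _ _ _ _ _ _ (@powR R ^~ m)) => //.
  exact: measurableT_comp.
have i1 U V : gaussian_pair U V -> rintegrable P (fun w => `|U w| `^ m).
  by move=> /gaussian_pair_law[s /normal_law_moment/(_ m0)[]].
have mpow n a (U : Omega -> R) : measurable_fun setT U ->
    measurable_fun setT (fun w => sine_power n (a * U w)).
  move=> mU; apply: (measurableT_comp (measurable_sine_power n)).
  exact: measurable_funM.
have iodd : rintegrable P (fun w => odd_power m (N w)).
  apply: le_rintegrable (i1 _ _ NY).
    exact: (measurableT_comp (measurable_odd_power m)).
  by move=> w; rewrite normr_odd_power//; lra.
apply: odd_power_of_sine_orthogonal => //.
  apply: le_rintegrable (gaussian_pair_rintegrable YN m0 m0).
    apply: measurable_funM; first exact: mm.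
    exact: (measurableT_comp (measurable_odd_power m)).
  move=> w; rewrite normrM (ger0_norm (powR_ge0 _ _)) normr_odd_power//; lra.
move=> n a; under eq_Rintegral do rewrite mulrC.
have ipow : rintegrable P (fun w => sine_power n (a * Y w)).
  apply: (@bounded_rintegrable _ _ _ P 1); first exact: mpow.
  by move=> w; exact: normr_sine_power_le1.
apply: odd_power_of_sine_orthogonal => //.
  have := bounded_rintegrableM (mpow n a _ mY)
    (fun w => normr_sine_power_le1 n (a * Y w)) (i1 _ _ NY).
  by apply: eq_rintegrable => w; rewrite mulrC.
move=> k b; apply: sine_power_orthogonal => //.
  exact: measurable_funM.
move=> c; under eq_Rintegral do rewrite mulrC.
apply: sine_power_orthogonal.
- exact: measurable_funM.
- apply: (@bounded_rintegrable _ _ _ P 1); last by move=> w; exact: sin_max.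
  by apply: measurable_sinM; exact: measurable_funM.
move=> e; rewrite -(gaussian_pair_sin (e * a) (c * b) YN cov0).
by apply: eq_Rintegral => w _; rewrite !mulrA.
Qed.

Definition correlation_const m n : R := n%:R * 4 * moment_const (2 * m).

Lemma correlation_const_ge0 m n : 0 <= correlation_const m n.
Proof. by rewrite /correlation_const mulr_ge0 ?moment_const_ge0// mulr_ge0. Qed.

(** Subtracting E[phi Y phi N] = 0 with N = Z - rho Y leaves an increment of phi
    over a distance |rho Y|, which yields the factor |rho|; the moments of order
    2m of Y, Z and N are all at most a constant times [v ^ m], since N has
    variance (1 - rho ^ 2) v. *)
Lemma gaussian_pair_odd_power_bound m n v rho Y Z : 1 < m <= n%:R ->
  gaussian_pair Y Z ->
  \int[P]_w (Y w ^+ 2) = v -> \int[P]_w (Z w ^+ 2) = v ->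
  \int[P]_w (Y w * Z w) = rho * v ->
  `|\int[P]_w (odd_power m (Y w) * odd_power m (Z w))| <=
    correlation_const m n * `|rho| * v `^ m.
Proof.
move=> mn; have /andP[m1 _] := mn.
have m_neq0 : m != 0 by lra.
have m0 : 0 <= m by lra.
have m'0 : 0 <= m - 1 by lra.
have m2 : 0 <= 2 * m by lra.
have m10 : 0 < m + 1 by lra.
move=> YZ Yv Zv YZv; have ZY := gaussian_pairC YZ.
pose N w := Z w - rho * Y w.
have YN : gaussian_pair Y N by exact: gaussian_pair_shear.
have NY := gaussian_pairC YN.
have v0 : 0 <= v by rewrite -Yv Rintegral_ge0// => w _; exact: sqr_ge0.
have iphi U V : gaussian_pair U V ->
    rintegrable P (fun w => odd_power m (U w) * odd_power m (V w)).
  move=> UV; apply: le_rintegrable (gaussian_pair_rintegrable UV m0 m0).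
    apply: measurable_funM; apply: (measurableT_comp (measurable_odd_power m)).
      exact: gaussian_pair_measurable UV.
    exact: gaussian_pair_measurable (gaussian_pairC UV).
  by move=> w; rewrite normrM !normr_odd_power.
have cov0 : \int[P]_w (Y w * N w) = 0.
  transitivity (\int[P]_w (Y w * Z w - rho * Y w ^+ 2)).
    by apply: eq_Rintegral => w _; rewrite /N; ring.
  have iY := gaussian_pair_sqr YZ.
  rewrite RintegralB ?RintegralZl//; last exact: rintegrableZl.
    by rewrite YZv Yv subrr.
  exact: gaussian_pair_rintegrableM.
have Nv : \int[P]_w (N w ^+ 2) <= v.
  have -> : \int[P]_w (N w ^+ 2) = \int[P]_w (((- rho) * Y w + 1 * Z w) ^+ 2).
    by apply: eq_Rintegral => w _; congr (_ ^+ 2); rewrite /N; ring.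
  rewrite gaussian_pair_variance// Yv Zv YZv; have := sqr_ge0 rho; nra.
have mom U V : gaussian_pair U V -> \int[P]_w (U w ^+ 2) <= v ->
    rintegrable P (fun w => `|U w| `^ (2 * m)) /\
    \int[P]_w (`|U w| `^ (2 * m)) <= moment_const (2 * m) * v `^ m.
  move=> /gaussian_pair_law[s Us] Uv; split.
    exact: (normal_law_moment Us m2).1.
  rewrite (normal_law_momentE Us m2) (_ : 2 * m / 2 = m); last by field.
  rewrite ler_wpM2l ?moment_const_ge0// ge0_ler_powR ?nnegrE//.
  by rewrite Rintegral_ge0// => w _; exact: sqr_ge0.
have lev (x : R) : x = v -> x <= v by move=> ->.
have [iY bY] := mom _ _ YZ (lev _ Yv).
have [iZ bZ] := mom _ _ ZY (lev _ Zv).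
have [iN bN] := mom _ _ NY Nv.
pose S w := `|Y w| `^ (2 * m) + `|Y w| `^ (2 * m) +
  (`|Z w| `^ (2 * m) + `|N w| `^ (2 * m)).
have iS : rintegrable P S by apply: rintegrableD; apply: rintegrableD.
have bS : \int[P]_w S w <= 4 * moment_const (2 * m) * v `^ m.
  rewrite !RintegralD//; try exact: rintegrableD.
  rewrite [leRHS](_ : _ = let c := moment_const (2 * m) * v `^ m in
    c + c + (c + c)); last by rewrite /=; ring.
  exact: lerD (lerD bY bY) (lerD bZ bN).
have -> : \int[P]_w (odd_power m (Y w) * odd_power m (Z w)) =
    \int[P]_w (odd_power m (Y w) * odd_power m (Z w) -
      odd_power m (Y w) * odd_power m (N w)).
  rewrite RintegralB//; [|exact: iphi|exact: iphi].
  by rewrite (gaussian_pair_odd_power_uncorrelated m1 YN cov0) subr0.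
have iD := rintegrableB (iphi _ _ YZ) (iphi _ _ YN).
apply: le_trans (le_normr_Rintegral measurableT iD) _.
apply: (@le_trans _ _ (\int[P]_w (n%:R * `|rho| * S w))); last first.
  rewrite RintegralZl//.
  rewrite [leRHS](_ : _ = n%:R * `|rho| * (4 * moment_const (2 * m) * v `^ m)).
    by rewrite ler_wpM2l// mulr_ge0.
  by rewrite /correlation_const; ring.
apply: le_Rintegral => //.
- exact: rintegrable_norm.
- exact: rintegrableZl.
move=> w _; rewrite -mulrBr normrM normr_odd_power//.
have := odd_power_locally_lipschitz (Z w) (N w) mn.
have -> : Z w - N w = rho * Y w by rewrite /N; ring.
rewrite normrM => lip.
have b1 := normr_powRM_le (Y w) (Z w) (ltW m10) m'0.
have b2 := normr_powRM_le (Y w) (N w) (ltW m10) m'0.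
have Em : m + 1 + (m - 1) = 2 * m by ring.
rewrite Em in b1 b2.
have EY : `|Y w| `^ m * `|Y w| = `|Y w| `^ (m + 1).
  by rewrite mulrC -[m in LHS](addrK 1) mulr_powRB1.
apply: (@le_trans _ _ (n%:R * `|rho| *
  (`|Y w| `^ (m + 1) * `|Z w| `^ (m - 1) + `|Y w| `^ (m + 1) * `|N w| `^ (m - 1)))).
  apply: le_trans (ler_wpM2l (powR_ge0 _ _) lip) _.
  by rewrite -EY le_eqVlt; apply/orP; left; apply/eqP; ring.
rewrite ler_wpM2l ?mulr_ge0//.
apply: le_trans (lerD b1 b2) _; rewrite /S.
by rewrite le_eqVlt; apply/orP; left; apply/eqP; ring.
Qed.

End gaussian_pair.

(** * Second moment of the time integral of a process *)

Lemma normr_le_1Dsqr (R : realType) (x : R) : `|x| <= 1 + x ^+ 2.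
Proof.
rewrite -[x ^+ 2]real_normK ?num_real//; have := normr_ge0 x.
by move: `|x| => y; have := sqr_ge0 (y - 1); nra.
Qed.

Lemma normrM_le_half (R : realType) (x y : R) :
  `|x * y| <= 2^-1 * (x ^+ 2 + y ^+ 2).
Proof.
rewrite normrM -[x ^+ 2]real_normK ?num_real// -[y ^+ 2]real_normK ?num_real//.
by have := sqr_ge0 (`|x| - `|y|); move: `|x| `|y| => u v; nra.
Qed.

Lemma normrM_le_sqrD (R : realType) (x y : R) : `|x * y| <= x ^+ 2 + y ^+ 2.
Proof.
rewrite (le_trans (normrM_le_half _ _))//.
by have := addr_ge0 (sqr_ge0 x) (sqr_ge0 y); lra.
Qed.

Section time_integral.
Context d (Omega : measurableType d) (R : realType) (P : probability Omega R).
Notation mu := (@lebesgue_measure R).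
Variables (T M : R) (A : R -> Omega -> R).
Hypothesis T0 : 0 < T.
Hypothesis mA : measurable_fun setT (fun z : R * Omega => A z.1 z.2).
Hypothesis A_supp : forall s w, s \notin `[0, T] -> A s w = 0.
Hypothesis intA2 : forall s, rintegrable P (fun w => A s w ^+ 2).
Hypothesis A2M : forall s, \int[P]_w (A s w ^+ 2) <= M.

Let I (s : R) : R := \1_(`[0, T]%classic) s.

Let IE s : I s = (s \in `[0, T])%:R.
Proof. by rewrite /I indicE mem_setE. Qed.

Let mAs s : measurable_fun setT (A s).
Proof. exact: (measurableT_comp mA (measurable_pair1 s)). Qed.

Let mAw w : measurable_fun setT (A ^~ w).
Proof. exact: (measurableT_comp mA (measurable_pair2 w)). Qed.

Let M0 : 0 <= M.
Proof. by apply: le_trans (A2M 0); rewrite Rintegral_ge0// => w _; exact: sqr_ge0. Qed.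

Let integral_I (c : R) : 0 <= c -> (\int[mu]_s (c * I s)%:E = (c * T)%:E)%E.
Proof.
move=> c0; under eq_integral do rewrite EFinM.
rewrite ge0_integralZl_EFin//; last 2 first.
- by move=> s _; rewrite lee_fin IE.
- by apply/measurable_EFinP; exact: measurable_indic.
have -> : (\int[mu]_s (I s)%:E = mu `[0%R, T]%classic)%E.
  by rewrite /I integral_indic// setIT.
by rewrite lebesgue_measure_itv/= lte_fin T0 -EFinB -EFinM subr0.
Qed.

Lemma time_pair_rintegrable s t : rintegrable P (fun w => A s w * A t w).
Proof.
apply: le_rintegrable (rintegrableD (intA2 s) (intA2 t)).
  exact: measurable_funM.
by move=> w; exact: normrM_le_sqrD.
Qed.

Let pair_bound s t : (\int[P]_w `|A s w * A t w|%:E <= (M * I s * I t)%:E)%E.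
Proof.
rewrite !IE; have [sT|sT] := boolP (s \in `[0, T]); last first.
  rewrite mulr0 mul0r integral0_eq// => w _.
  by rewrite A_supp// mul0r normr0.
have [tT|tT] := boolP (t \in `[0, T]); last first.
  rewrite mulr0 integral0_eq// => w _.
  by rewrite (A_supp _ tT) mulr0 normr0.
rewrite !mulr1 -(EFin_Rintegral (rintegrable_norm (time_pair_rintegrable s t))) lee_fin.
apply: (@le_trans _ _ (\int[P]_w (2^-1 * (A s w ^+ 2 + A t w ^+ 2)))).
  apply: le_Rintegral => //.
  - exact: rintegrable_norm (time_pair_rintegrable s t).
  - by apply: rintegrableZl; exact: rintegrableD.
  by move=> w _; exact: normrM_le_half.
rewrite RintegralZl//; last exact: rintegrableD.
by rewrite RintegralD//; have := A2M s; have := A2M t; lra.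
Qed.

(** The process vanishes off [0, T], so that integrating over the whole line
    loses nothing and keeps all the iterated integrals on full spaces. *)
Definition time_integral (w : Omega) : R := \int[mu]_s A s w.

Notation V := time_integral.

Let intAw : (\int[mu]_s \int[P]_w `|A s w|%:E < +oo)%E.
Proof.
apply: (@le_lt_trans _ _ (\int[mu]_s ((1 + M) * I s)%:E)%E); last first.
  by rewrite integral_I ?ltry// addr_ge0.
apply: ge0_le_integral => //.
- by move=> s _; exact: integral_ge0.
- apply: (measurable_fun_fubini_tonelli_F (fun z => `|A z.1 z.2|%:E)) => //.
  by apply/measurable_EFinP; exact: measurableT_comp.
- by apply/measurable_EFinP; apply: measurable_funM => //; exact: measurable_indic.
move=> s _; rewrite IE; have [sT|sT] := boolP (s \in `[0, T]); last first.
  rewrite mulr0 integral0_eq// => w _.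
  by rewrite A_supp// normr0.
have i1 : rintegrable P (fun=> 1 : R).
  by apply: (@bounded_rintegrable _ _ _ P 1) => // w; rewrite normr1.
have iS := rintegrableD i1 (intA2 s).
have iA : rintegrable P (A s).
  by apply: le_rintegrable iS => // w; exact: normr_le_1Dsqr.
rewrite mulr1 -(EFin_Rintegral (rintegrable_norm iA)) lee_fin.
apply: (@le_trans _ _ (\int[P]_w (1 + A s w ^+ 2))).
  apply: le_Rintegral => //; first exact: rintegrable_norm.
  by move=> w _; exact: normr_le_1Dsqr.
rewrite RintegralD//; apply: lerD => //.
rewrite /Rintegral integral_cst// mul1e; change (fine (P setT) <= 1).
by rewrite probability_setT.
Qed.

Lemma rintegrable_time_integral : rintegrable P V.
Proof. by have [_ + _] := Rintegral_Fubini (m1 := mu) (m2 := P) mA intAw. Qed.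

Let mV : measurable_fun setT V.
Proof. exact: rintegrable_measurable rintegrable_time_integral. Qed.

Let ae_intA : {ae P, forall w, rintegrable mu (A ^~ w)}.
Proof.
apply: (@ae_integrable2 _ _ _ _ R mu P (fun z => (A z.1 z.2)%:E)).
by apply/integrable12ltyP => //; exact/measurable_EFinP.
Qed.

(** [V] is dominated by the possibly infinite [U], the time integral of |A|.
    By Tonelli the mean of [U ^ 2] is the double integral of E[|A s A t|], at most
    [M * T ^ 2]. *)
Lemma rintegrable_time_integral_sqr : rintegrable P (fun w => V w ^+ 2).
Proof.
pose U w := (\int[mu]_s `|A s w|%:E)%E.
have mabs : measurable_fun setT (fun z : R * Omega => `|A z.1 z.2|%:E).
  by apply/measurable_EFinP; exact: measurableT_comp.
have mabsw w : measurable_fun setT (fun s : measurableTypeR R => `|A s w|%:E).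
  by apply/measurable_EFinP; apply: measurableT_comp => //; exact: mAw.
have mU : measurable_fun setT U.
  by apply: (measurable_fun_fubini_tonelli_G (m1 := mu) (fun z => `|A z.1 z.2|%:E)).
have U0 w : (0 <= U w)%E by exact: integral_ge0.
have VU w : ((V w ^+ 2)%:E <= U w * U w)%E.
  have VU1 : (`|V w|%:E <= U w)%E.
    have mEA : measurable_fun setT (EFin \o (A ^~ w)) by exact/measurable_EFinP.
    apply: le_trans (le_abse_integral mu measurableT mEA).
    rewrite /V /Rintegral; move: (\int[mu]_s _)%E => -[r| |]//=;
      by rewrite normr0 leey.
  rewrite -[V w ^+ 2]real_normK ?num_real// expr2 EFinM.
  by apply: lee_pmul => //; rewrite lee_fin.
apply/ge0_rintegrableP; [exact: measurable_funX|by move=> w; exact: sqr_ge0|].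
apply: (@le_lt_trans _ _ (\int[P]_w (U w * U w))%E).
  apply: ge0_le_integral => //.
  - by move=> w _; rewrite lee_fin sqr_ge0.
  - by apply/measurable_EFinP; exact: measurable_funX.
  - exact: emeasurable_funM.
pose f (z : R * Omega) := (`|A z.1 z.2|%:E * U z.2)%E.
have mf : measurable_fun setT f.
  by apply: emeasurable_funM => //; exact: measurableT_comp.
have f0 z : (0 <= f z)%E by rewrite mule_ge0.
have -> : (\int[P]_w (U w * U w) = \int[mu]_s \int[P]_w f (s, w))%E.
  apply: esym; apply: eq_trans (fubini_tonelli (m1 := mu) (m2 := P) f mf f0) _.
  apply: eq_integral => w _.
  by rewrite /f /= ge0_integralZr.
apply: (@le_lt_trans _ _ (\int[mu]_s (M * T * I s)%:E)%E); last first.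
  by rewrite integral_I ?ltry// mulr_ge0// ltW.
apply: ge0_le_integral => //.
- by move=> s _; exact: integral_ge0.
- exact: (measurable_fun_fubini_tonelli_F (m2 := P) f).
- by apply/measurable_EFinP; apply: measurable_funM => //; exact: measurable_indic.
move=> s _; pose g (z : R * Omega) : \bar R := `|A s z.2 * A z.1 z.2|%:E.
have g0 z : (0 <= g z)%E by rewrite lee_fin.
have mg : measurable_fun setT g.
  apply/measurable_EFinP/measurableT_comp => //; apply: measurable_funM => //.
  exact: measurableT_comp.
have -> : (\int[P]_w f (s, w) = \int[mu]_t \int[P]_w g (t, w))%E.
  apply: esym; apply: eq_trans (fubini_tonelli (m1 := mu) (m2 := P) g mg g0) _.
  apply: eq_integral => w _.
  rewrite /f /g /= -ge0_integralZl//.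
  by apply: eq_integral => t _; rewrite normrM EFinM.
have -> : (M * T * I s)%:E = (\int[mu]_t (M * I s * I t)%:E)%E.
  by rewrite integral_I ?mulr_ge0//; congr (_%:E); ring.
apply: ge0_le_integral => //.
- by move=> t _; exact: integral_ge0.
- exact: (measurable_fun_fubini_tonelli_F (m2 := P) g).
- by apply/measurable_EFinP; apply: measurable_funM => //; exact: measurable_indic.
- by move=> t _; exact: pair_bound.
Qed.

Lemma rintegrable_time_integralM s : rintegrable P (fun w => A s w * V w).
Proof.
apply: le_rintegrable (rintegrableD (intA2 s) rintegrable_time_integral_sqr).
  exact: measurable_funM.
by move=> w; exact: normrM_le_sqrD.
Qed.

(** The inner real integral of a path that is not integrable is meaningless, so
    the factor [A s w] can only be moved out of it almost surely. *)
Lemma time_integralM s :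
  rintegrable mu (fun t => \int[P]_w (A s w * A t w)) /\
  \int[P]_w (A s w * V w) = \int[mu]_t \int[P]_w (A s w * A t w).
Proof.
pose B t w := A s w * A t w.
have mB : measurable_fun setT (fun z : R * Omega => B z.1 z.2).
  by apply: measurable_funM => //; exact: measurableT_comp.
have Boo : (\int[mu]_t \int[P]_w `|B t w|%:E < +oo)%E.
  apply: (@le_lt_trans _ _ (\int[mu]_t (M * I s * I t)%:E)%E); last first.
    by rewrite integral_I ?ltry// mulr_ge0.
  apply: ge0_le_integral => //.
  - by move=> t _; exact: integral_ge0.
  - apply: (measurable_fun_fubini_tonelli_F (fun z => `|B z.1 z.2|%:E)) => //.
    by apply/measurable_EFinP; exact: measurableT_comp.
  - by apply/measurable_EFinP; apply: measurable_funM => //; exact: measurable_indic.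
  - by move=> t _; exact: pair_bound.
have [i1 i2 E] := Rintegral_Fubini (m1 := mu) (m2 := P) mB Boo.
split=> //; rewrite E; apply: ae_eq_Rintegral => //.
  exact: rintegrable_time_integralM.
by apply: filterS ae_intA => w intAw'; rewrite /B RintegralZl.
Qed.

Lemma time_integral_sqr :
  rintegrable mu (fun s => \int[P]_w (A s w * V w)) /\
  \int[P]_w (V w ^+ 2) = \int[mu]_s \int[P]_w (A s w * V w).
Proof.
pose B s w := A s w * V w.
have mB : measurable_fun setT (fun z : R * Omega => B z.1 z.2).
  by apply: measurable_funM => //; exact: measurableT_comp.
pose K := M + \int[P]_w (V w ^+ 2).
have K0 : 0 <= K.
  by rewrite addr_ge0// Rintegral_ge0// => w _; exact: sqr_ge0.
have Boo : (\int[mu]_s \int[P]_w `|B s w|%:E < +oo)%E.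
  apply: (@le_lt_trans _ _ (\int[mu]_s (K * I s)%:E)%E); last first.
    by rewrite integral_I ?ltry.
  apply: ge0_le_integral => //.
  - by move=> s _; exact: integral_ge0.
  - apply: (measurable_fun_fubini_tonelli_F (fun z => `|B z.1 z.2|%:E)) => //.
    by apply/measurable_EFinP; exact: measurableT_comp.
  - by apply/measurable_EFinP; apply: measurable_funM => //; exact: measurable_indic.
  move=> s _; rewrite IE; have [sT|sT] := boolP (s \in `[0, T]); last first.
    rewrite mulr0 integral0_eq// => w _.
    by rewrite /B A_supp// mul0r normr0.
  have iB := rintegrable_norm (rintegrable_time_integralM s).
  rewrite mulr1 -(EFin_Rintegral iB) lee_fin.
  have V2 := rintegrable_time_integral_sqr.
  apply: (@le_trans _ _ (\int[P]_w (A s w ^+ 2 + V w ^+ 2))).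
    apply: le_Rintegral => //; first exact: rintegrableD.
    by move=> w _; exact: normrM_le_sqrD.
  by rewrite RintegralD// lerD2r.
have [i1 i2 E] := Rintegral_Fubini (m1 := mu) (m2 := P) mB Boo.
split=> //; rewrite E; apply: ae_eq_Rintegral => //.
  exact: rintegrable_time_integral_sqr.
by apply: filterS ae_intA => w intAw'; rewrite /B RintegralZr// expr2.
Qed.

End time_integral.

(** * Increments of a process with concave variance function *)

Lemma Rintegral_indic_itv (R : realType) (a b : R) (x y : bool) : a < b ->
  let D := [set` Interval (BSide x a) (BSide y b)] in
  rintegrable (@lebesgue_measure R) (\1_D : R -> R) /\
  \int[@lebesgue_measure R]_t \1_D t = b - a.
Proof.
move=> ab D; split; first exact: integrable_indic_itv.
have mD : measurable D by exact: measurable_itv.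
transitivity (fine (@lebesgue_measure R D)).
  by rewrite /Rintegral integral_indic// setIT.
by rewrite lebesgue_measure_itv/= lte_fin ab.
Qed.

Section increments.
Context d (Omega : measurableType d) (R : realType) (P : probability Omega R).
Notation mu := (@lebesgue_measure R).
Variables (T eps0 : R) (X : R -> Omega -> R) (delta : R -> R).
Hypotheses (T_gt0 : 0 < T) (eps0_gt0 : 0 < eps0).
Notation Ts := (T + eps0).
Hypothesis X_measurable : measurable_process Ts X.
Hypothesis X_gaussian : centered_gaussian_process P Ts X.
Hypothesis X_increments : {in `[0, Ts] &, forall s t,
  ('E_P[fun w => ((X t w - X s w) ^+ 2)%R])%E = (delta `|t - s| ^+ 2)%:E}.
Hypothesis delta2_concave : concave_on Ts (fun r => delta r ^+ 2).

Lemma gaussian_combination4 (a b c e s t u v : R) :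
  s \in `[0, Ts] -> t \in `[0, Ts] -> u \in `[0, Ts] -> v \in `[0, Ts] ->
  exists k, has_centered_normal_law P
    (fun w => a * X s w + b * X t w + (c * X u w + e * X v w)) k.
Proof.
move=> hs ht hu hv.
pose p (i : 'I_4) := nth 0 [:: s; t; u; v] i.
pose q (i : 'I_4) := nth 0 [:: a; b; c; e] i.
have hp i : 0 <= p i <= Ts.
  by case: i => -[|[|[|[|//]]]] ?; rewrite /p/= -?in_itv.
have [k hk] := X_gaussian q hp; exists k.
rewrite (_ : (fun w => _) = fun w => \sum_i q i * X (p i) w)//.
apply/funext => w; rewrite !big_ord_recl big_ord0 addr0 /=.
by rewrite !addrA.
Qed.

Lemma rintegrable_increment_sqr s t : s \in `[0, Ts] -> t \in `[0, Ts] ->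
  rintegrable P (fun w => (X t w - X s w) ^+ 2).
Proof.
move=> hs ht; have [k] := gaussian_combination4 1 (-1) 0 0 ht hs hs hs.
move=> /rintegrable_normal_sqr; apply: eq_rintegrable => w.
by congr (_ ^+ 2); ring.
Qed.

Lemma increment_variance s t : s \in `[0, Ts] -> t \in `[0, Ts] ->
  \int[P]_w ((X t w - X s w) ^+ 2) = delta `|t - s| ^+ 2.
Proof.
by move=> hs ht; have := X_increments hs ht; rewrite unlock /Rintegral => ->.
Qed.

Variables (eps : R).
Hypotheses (eps_gt0 : 0 < eps) (eps_le : eps <= eps0).

(** The increment is set to 0 off [0, T], as required by [time_integral]. *)
Definition cut_increment (s : R) (w : Omega) : R :=
  if s \in `[0, T] then X (s + eps) w - X s w else 0.

Notation Y := cut_increment.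
Notation v := (delta eps ^+ 2).

Let in_Ts (s : R) : s \in `[0, T] -> s \in `[0, Ts].
Proof. by rewrite !in_itv/= => /andP[-> sT]; rewrite (le_trans sT)// lerDl ltW. Qed.

Let in_Ts_eps (s : R) : s \in `[0, T] -> s + eps \in `[0, Ts].
Proof. by rewrite !in_itv/= => /andP[s0 sT]; rewrite addr_ge0 ?(ltW eps_gt0)// lerD. Qed.

Lemma cut_increment_supp s w : s \notin `[0, T] -> Y s w = 0.
Proof. by rewrite /Y => /negbTE ->. Qed.

Lemma measurable_cut_increment :
  measurable_fun setT (fun z : R * Omega => Y z.1 z.2).
Proof.
pose D : set (R * Omega) := `[0, Ts]%classic `*` setT.
have mD : measurable D by exact: measurableX.
pose g := (fun z : R * Omega => X z.1 z.2) \_ D.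
have mg : measurable_fun setT g by apply: (measurable_restrictT _ mD).1.
have mshift : measurable_fun setT (fun z : R * Omega => g (z.1 + eps, z.2)).
  apply: (measurableT_comp mg); apply: measurable_fun_pair => //.
  exact: measurable_funD.
rewrite (_ : (fun z => _) = fun z : R * Omega =>
    \1_(`[0, T]%classic) z.1 * (g (z.1 + eps, z.2) - g z)).
  apply: measurable_funM; last exact: measurable_funB.
  by apply: (measurableT_comp (measurable_indic _)) => //.
apply/funext => -[s w] /=; rewrite indicE mem_setE /Y; case: ifPn => sT /=.
  rewrite mul1r /g !patchE !mem_set//; split => //=; first exact: in_Ts.
  exact: in_Ts_eps.
by rewrite mul0r.
Qed.

Lemma cut_increment_gaussian s t : s \in `[0, T] -> t \in `[0, T] ->
  gaussian_pair P (Y s) (Y t).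
Proof.
move=> sT tT a b.
have [k hk] := gaussian_combination4 a (- a) b (- b) (in_Ts_eps sT) (in_Ts sT)
  (in_Ts_eps tT) (in_Ts tT).
exists k; rewrite (_ : (fun w => _) = fun w => a * X (s + eps) w + - a * X s w +
  (b * X (t + eps) w + - b * X t w))//.
by apply/funext => w; rewrite /Y sT tT; ring.
Qed.

Lemma cut_increment_variance s : s \in `[0, T] -> \int[P]_w (Y s w ^+ 2) = v.
Proof.
move=> sT; transitivity (\int[P]_w ((X (s + eps) w - X s w) ^+ 2)).
  by apply: eq_Rintegral => w _; rewrite /Y sT.
rewrite (increment_variance (in_Ts sT) (in_Ts_eps sT)).
by rewrite (addrC s) addrK gtr0_norm.
Qed.

Lemma cut_increment_covariance s t : s \in `[0, T] -> t \in `[0, T] ->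
  \int[P]_w (Y s w * Y t w) = 2^-1 * (delta `|t - s - eps| ^+ 2 +
    delta `|t - s + eps| ^+ 2) - delta `|t - s| ^+ 2.
Proof.
move=> sT tT; have [s0 s1 t0 t1] := And4 (in_Ts sT) (in_Ts_eps sT)
  (in_Ts tT) (in_Ts_eps tT).
pose S p q w := (X q w - X p w) ^+ 2.
have iS p q : p \in `[0, Ts] -> q \in `[0, Ts] -> rintegrable P (S p q).
  exact: rintegrable_increment_sqr.
transitivity (\int[P]_w (2^-1 * (S (s + eps) t w + S s (t + eps) w) -
    2^-1 * (S (s + eps) (t + eps) w + S s t w))).
  by apply: eq_Rintegral => w _; rewrite /S /Y sT tT; field.
have [i1 i2 i3 i4] := And4 (iS _ _ s1 t0) (iS _ _ s0 t1) (iS _ _ s1 t1) (iS _ _ s0 t0).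
rewrite RintegralB//; try by apply: rintegrableZl; exact: rintegrableD.
rewrite !RintegralZl//; try exact: rintegrableD.
rewrite !RintegralD// /S !increment_variance//.
rewrite (_ : t - (s + eps) = t - s - eps); last by ring.
rewrite (_ : t + eps - s = t - s + eps); last by ring.
rewrite (_ : t + eps - (s + eps) = t - s); last by ring.
by field.
Qed.

(** Up to the factor 1/2 the covariance is the second difference of [delta ^ 2]
    at |t - s| with step [eps].  The condition eps <= |t - s| keeps the three
    points in [0, T + eps0], where concavity applies. *)
Lemma cut_increment_covariance_le0 s t : s \in `[0, T] -> t \in `[0, T] ->
  eps <= `|t - s| -> \int[P]_w (Y s w * Y t w) <= 0.
Proof.
move=> sT tT; wlog st : s t sT tT / s <= t => [wlg|].
  have [st|/ltW ts] := leP s t; first exact: wlg.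
  by rewrite distrC => ?; under eq_Rintegral do rewrite mulrC; exact: wlg.
rewrite (ger0_norm (_ : 0 <= t - s)) ?subr_ge0// => epsts.
rewrite cut_increment_covariance// !ger0_norm ?subr_ge0//; last first.
  by rewrite addr_ge0 ?subr_ge0 ?(ltW eps_gt0).
have half0 : 0 <= (2^-1 : R) by lra.
have half1 : (2^-1 : R) <= 1 by lra.
pose h : {i01 R} := Itv01 half0 half1.
move: sT tT; rewrite !in_itv/= => /andP[s0 sT] /andP[t0 tT].
have tsT : t - s <= T by rewrite (le_trans _ tT)// lerBlDr lerDl.
have xI : t - s - eps \in `[0, Ts]%classic.
  rewrite mem_setE in_itv/= subr_ge0 epsts/= lerBlDr.
  by rewrite (le_trans tsT)// -addrA lerDl addr_ge0 ?ltW.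
have yI : t - s + eps \in `[0, Ts]%classic.
  by rewrite mem_setE in_itv/= addr_ge0 ?subr_ge0 ?(ltW eps_gt0)//= lerD.
have := delta2_concave h xI yI.
set c := (X in (\- _) X <= _); have -> : c = t - s.
  transitivity (2^-1 * (t - s - eps) + (1 - 2^-1) * (t - s + eps)); first by [].
  by field.
rewrite !convRE /= /unstable.onem.
move: (delta _ ^+ 2) (delta _ ^+ 2) (delta _ ^+ 2) => x y z; lra.
Qed.

Notation A m := (fun s w => odd_power m (Y s w)).

(** The correlation rho = E[Y s Y t] / v satisfies
    |rho| <= 2 * 1_(|t - s| < eps) - rho: near the diagonal because |rho| <= 1,
    elsewhere because rho <= 0.  In this form the correlation enters linearly,
    so that it can be integrated.  When [v = 0] the covariance vanishes too, in
    agreement with the convention 1 / 0 = 0. *)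
Lemma odd_power_covariance_le m n s t : 1 < m <= n%:R ->
  \int[P]_w (A m s w * A m t w) <= correlation_const m n * v `^ m *
    (2 * \1_(`]s - eps, s + eps[%classic) t - v^-1 * \int[P]_w (Y s w * Y t w)).
Proof.
move=> mn; have /andP[m1 _] := mn; set K := correlation_const m n.
have K0 : 0 <= K by exact: correlation_const_ge0.
have Kv0 : 0 <= K * v `^ m by rewrite mulr_ge0// powR_ge0.
have Z u w : u \notin `[0, T] -> A m u w = 0.
  by move=> uT; rewrite cut_increment_supp// odd_power0.
have [sT|sT] := boolP (s \in `[0, T]); last first.
  under eq_Rintegral do rewrite Z// mul0r.
  under [in leRHS]eq_Rintegral do rewrite cut_increment_supp// mul0r.
  rewrite /Rintegral integral0 mulr0 subr0 mulr_ge0// mulr_ge0//.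
have [tT|tT] := boolP (t \in `[0, T]); last first.
  under eq_Rintegral do rewrite (Z _ _ tT) mulr0.
  under [in leRHS]eq_Rintegral do rewrite (cut_increment_supp _ tT) mulr0.
  rewrite /Rintegral integral0 mulr0 subr0 mulr_ge0// mulr_ge0//.
have YY := cut_increment_gaussian sT tT.
set c := \int[P]_w (Y s w * Y t w).
have v0 : 0 <= v by exact: sqr_ge0.
have cv : `|c| <= v.
  apply: le_trans (le_normr_Rintegral measurableT (gaussian_pair_rintegrableM YY)) _.
  have i1 := gaussian_pair_sqr YY.
  have i2 := gaussian_pair_sqr (gaussian_pairC YY).
  have -> : v = \int[P]_w (2^-1 * (Y s w ^+ 2 + Y t w ^+ 2)).
    rewrite RintegralZl ?RintegralD ?cut_increment_variance//; first by field.
    exact: rintegrableD.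
  apply: le_Rintegral => //.
  - exact: rintegrable_norm (gaussian_pair_rintegrableM YY).
  - by apply: rintegrableZl; exact: rintegrableD.
  - by move=> w _; exact: normrM_le_half.
pose rho := v^-1 * c.
have rhov : c = rho * v.
  have [vz|vz] := eqVneq v 0; last by rewrite /rho mulrAC mulVf// mul1r.
  by move: cv; rewrite vz normr_le0 mulr0 => /eqP.
have := gaussian_pair_odd_power_bound mn YY (cut_increment_variance sT)
  (cut_increment_variance tT) rhov.
rewrite -/K => /(le_trans (ler_norm _)) /le_trans; apply.
rewrite mulrAC ler_wpM2l// -/rho indicE mem_setE.
case: (boolP (t \in _)) => st /=.
  have : `|rho| <= 1.
    have [vz|vz] := eqVneq v 0; first by rewrite /rho vz invr0 mul0r normr0.
    have vp : 0 < v by rewrite lt_neqAle eq_sym vz.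
    by rewrite /rho normrM gtr0_norm ?invr_gt0// ler_pdivrMl// mulr1.
  by rewrite mulr1; have := ler_norm rho; move: `|rho| (rho) => x y; lra.
rewrite mulr0 sub0r ler0_norm// /rho mulr_ge0_le0 ?invr_ge0//.
apply: cut_increment_covariance_le0 => //.
move: st; rewrite in_itv/= -ltr_distlC distrC -leNgt//.
Qed.

(** Integrated twice over [0, T], the indicator in [odd_power_covariance_le]
    contributes at most 4 eps T, and the covariance contributes minus a second
    moment, which is dropped. *)
Lemma odd_power_time_integral_sqr_le m n : 1 < m <= n%:R ->
  [/\ measurable_fun setT (time_integral (A m)),
      rintegrable P (fun w => time_integral (A m) w ^+ 2)
    & \int[P]_w (time_integral (A m) w ^+ 2) <=
      4 * correlation_const m n * T * eps * v `^ m].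
Proof.
move=> mn; have /andP[m1 _] := mn; set K := correlation_const m n.
pose V := time_integral (A m); rewrite -/V.
have K0 : 0 <= K by exact: correlation_const_ge0.
have Kv0 : 0 <= K * v `^ m by rewrite mulr_ge0// powR_ge0.
have v0 : 0 <= v by exact: sqr_ge0.
pose I s : R := \1_(`[0, T]%classic) s.
have IE s : I s = (s \in `[0, T])%:R by rewrite /I indicE mem_setE.
have mY := measurable_cut_increment.
have mA : measurable_fun setT (fun z : R * Omega => A m z.1 z.2).
  exact: (measurableT_comp (measurable_odd_power m)).
have sY s w : s \notin `[0, T] -> Y s w = 0 by exact: cut_increment_supp.
have sA s w : s \notin `[0, T] -> A m s w = 0.
  by move=> sT; rewrite sY// odd_power0.
have i0 : rintegrable P (fun=> 0 : R) by exact: integrable0.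
have iY s : rintegrable P (fun w => Y s w ^+ 2).
  have [sT|sT] := boolP (s \in `[0, T]).
    exact: gaussian_pair_sqr (cut_increment_gaussian sT sT).
  by apply: eq_rintegrable i0 => w; rewrite sY// expr0n.
have bY s : \int[P]_w (Y s w ^+ 2) <= v.
  have [sT|sT] := boolP (s \in `[0, T]); first by rewrite cut_increment_variance.
  under eq_Rintegral do rewrite sY// expr0n.
  by rewrite /Rintegral integral0.
have m2 : 0 <= 2 * m by lra.
have AE s w : A m s w ^+ 2 = `|Y s w| `^ (2 * m).
  rewrite -[_ ^+ 2]real_normK ?num_real// normr_odd_power; last lra.
  by rewrite mulrC powRrM powR_mulrn// powR_ge0.
pose M := moment_const (2 * m) * v `^ m.
have iA s : rintegrable P (fun w => A m s w ^+ 2).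
  have [sT|sT] := boolP (s \in `[0, T]); last first.
    by apply: eq_rintegrable i0 => w; rewrite sA// expr0n.
  have [k h] := gaussian_pair_law (cut_increment_gaussian sT sT).
  by apply: eq_rintegrable (normal_law_moment h m2).1 => w; rewrite AE.
have bA s : \int[P]_w (A m s w ^+ 2) <= M.
  have [sT|sT] := boolP (s \in `[0, T]); last first.
    under eq_Rintegral do rewrite sA// expr0n.
    by rewrite /Rintegral integral0 mulr_ge0 ?powR_ge0// moment_const_ge0.
  have [k h] := gaussian_pair_law (cut_increment_gaussian sT sT).
  under eq_Rintegral do rewrite AE.
  rewrite (normal_law_momentE h m2) cut_increment_variance//.
  by rewrite (_ : 2 * m / 2 = m)//; field.
pose W := time_integral Y.
have V1 := rintegrable_time_integral T_gt0 mA sA iA bA.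
have V2 := rintegrable_time_integral_sqr T_gt0 mA sA iA bA.
split=> //; first exact: rintegrable_measurable V1.
have [iV ->] := time_integral_sqr T_gt0 mA sA iA bA.
have [iW EW] := time_integral_sqr T_gt0 mY sY iY bY.
have inner s : \int[P]_w (A m s w * V w) <=
    K * v `^ m * (4 * eps * I s - v^-1 * \int[P]_w (Y s w * W w)).
  have [iAA ->] := time_integralM T_gt0 mA sA iA bA s.
  have [iYY ->] := time_integralM T_gt0 mY sY iY bY s.
  have [sT|sT] := boolP (s \in `[0, T]); last first.
    rewrite [leLHS](_ : _ = 0); last first.
      rewrite /Rintegral /=; under eq_integral do under eq_integral do rewrite sA// mul0r.
      by under eq_integral do rewrite integral0; rewrite integral0.
    rewrite [X in _ - _ * X](_ : _ = 0); last first.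
      rewrite /Rintegral /=; under eq_integral do under eq_integral do rewrite sY// mul0r.
      by under eq_integral do rewrite integral0; rewrite integral0.
    by rewrite mulr0 subr0 mulr_ge0// mulr_ge0 ?IE// mulr_ge0// ltW.
  have se : s - eps < s + eps by rewrite ltrBlDr -addrA ltrDl addr_gt0.
  have [iJ EJ] := Rintegral_indic_itv false true se.
  have iJ2 := rintegrableZl 2 iJ.
  have iYv := rintegrableZl v^-1 iYY.
  have iB := rintegrableZl (K * v `^ m) (rintegrableB iJ2 iYv).
  apply: le_trans (le_Rintegral measurableT iAA iB _) _.
    by move=> t _; exact: odd_power_covariance_le.
  rewrite RintegralZl//; last exact: rintegrableB.
  rewrite RintegralB// !RintegralZl// EJ IE sT mulr1.
  by rewrite ler_wpM2l// lerD2r; lra.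
have [iI EI] := Rintegral_indic_itv true false T_gt0.
have iI4 := rintegrableZl (4 * eps) iI.
have iWv := rintegrableZl v^-1 iW.
have iB := rintegrableZl (K * v `^ m) (rintegrableB iI4 iWv).
apply: le_trans (le_Rintegral measurableT iV iB _) _.
  by move=> s _; exact: inner.
rewrite RintegralZl//; last exact: rintegrableB.
rewrite RintegralB// !RintegralZl// EI subr0 -EW.
have -> : 4 * K * T * eps * v `^ m = K * v `^ m * (4 * eps * T) by ring.
rewrite ler_wpM2l// lerBlDr lerDl mulr_ge0 ?invr_ge0//.
by rewrite Rintegral_ge0// => w _; exact: sqr_ge0.
Qed.

Lemma odd_variationE m w :
  odd_variation X m T eps w = eps^-1 * time_integral (A m) w.
Proof.
rewrite /odd_variation Rintegral_mkcond; congr (_ * _).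
apply: eq_Rintegral => s _; rewrite patchE mem_setE /Y.
by case: ifP => // _; rewrite odd_power0.
Qed.

End increments.

(** * Convergence to zero *)

Section conclusion.
Context d (Omega : measurableType d) (R : realType) (P : probability Omega R).

Lemma Lnorm2_le (f : Omega -> R) (C : R) : 0 <= C ->
  rintegrable P (fun w => f w ^+ 2) -> \int[P]_w (f w ^+ 2) <= C ^+ 2 ->
  ('N[P]_2%:E[EFin \o f] <= C%:E)%E.
Proof.
move=> C0 if2 bf.
have E : (\int[P]_w `|f w|%:E `^ 2 = (\int[P]_w (f w ^+ 2))%:E)%E.
  rewrite EFin_Rintegral//; apply: eq_integral => w _.
  by rewrite poweR_EFin powR_mulrn// real_normK ?num_real.
rewrite unlock /=.
rewrite [X in (X `^ _)%E]E poweR_EFin lee_fin.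
rewrite -[leRHS](ger0_norm C0) -sqrtr_sqr -powR12_sqrt ?sqr_ge0//.
by rewrite ge0_ler_powR ?nnegrE ?sqr_ge0// Rintegral_ge0// => w _; exact: sqr_ge0.
Qed.

Lemma Lfun2_sqr (f : Omega -> R) : measurable_fun setT f ->
  rintegrable P (fun w => f w ^+ 2) -> f \in Lfun P 2%:E.
Proof.
move=> mf if2; rewrite inE; apply/andP; split; rewrite inE//=.
have I0 : 0 <= \int[P]_w (f w ^+ 2).
  by rewrite Rintegral_ge0// => w _; exact: sqr_ge0.
apply: le_lt_trans (Lnorm2_le (C := Num.sqrt (\int[P]_w (f w ^+ 2))) _ if2 _) _.
- exact: sqrtr_ge0.
- by rewrite sqr_sqrtr.
- exact: ltry.
Qed.

Lemma cvg_L2_0 (I : Type) (F : set_system I) (FF : Filter F)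
    (f : I -> Omega -> R) (b : I -> R) :
  (\forall i \near F, [/\ measurable_fun setT (f i),
     rintegrable P (fun w => f i w ^+ 2) & \int[P]_w (f i w ^+ 2) <= b i]) ->
  (forall e, 0 < e -> \forall i \near F, b i <= e) ->
  cvg_L2 P F f (cst 0).
Proof.
move=> fb b0; split.
- by apply: filterS fb => i [mf if2 _]; exact: Lfun2_sqr.
- exact: Lfun_cst.
have N e : 0 < e -> \forall i \near F,
    ('N[P]_2%:E[EFin \o (f i \- cst 0)%R] <= e%:E)%E.
  move=> e0; have e20 : 0 < e ^+ 2 by rewrite exprn_gt0.
  apply: filterS2 fb (b0 _ e20) => i [mf if2 fi] bi.
  rewrite (_ : (f i \- cst 0) = f i); last by apply/funext => w /=; rewrite subr0.
  by apply: Lnorm2_le => //; [exact: ltW|exact: le_trans bi].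
apply/fine_cvgP; split.
  apply: filterS (N _ ltr01) => i Ni.
  by rewrite ge0_fin_numE ?Lnorm_ge0// (le_lt_trans Ni)// ltry.
apply/cvgr0Pnorm_le => e e0; apply: filterS (N _ e0) => i Ni /=.
rewrite ger0_norm ?fine_ge0 ?Lnorm_ge0// -lee_fin fineK//.
by rewrite ge0_fin_numE ?Lnorm_ge0// (le_lt_trans Ni)// ltry.
Qed.

(** The bound 4 K T (delta eps) ^ (2m) / eps of the second moment tends to 0: if
    delta eps <= c eps ^ (1 / (2m)), it is at most 4 K T c ^ (2m).  The
    constant [c] is taken to be (e / (4 K T + 1)) ^ (1 / (2m)) to get below [e]. *)
Lemma zero_odd_variation_concave (T eps0 : R) (X : R -> Omega -> R)
    (delta : R -> R) (m : R) :
  0 < T -> 0 < eps0 ->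
  measurable_process (T + eps0) X ->
  centered_gaussian_process P (T + eps0) X ->
  {in `[0, T + eps0] &, forall s t,
    ('E_P[fun w => ((X t w - X s w) ^+ 2)%R])%E = (delta `|t - s| ^+ 2)%:E} ->
  concave_on (T + eps0) (fun r => delta r ^+ 2) -> 1 < m ->
  (delta : R -> R^o) =o_ (0^'+) (fun r : R => r `^ (2 * m)^-1 : R^o) ->
  zero_odd_variation P X m T.
Proof.
move=> T0 e00 mX gX iX cX m1 od.
pose n := (Num.truncn m).+1.
have mn : 1 < m <= n%:R by rewrite m1 /n; have := truncnS_gt m; lra.
pose K := correlation_const m n.
have K0 : 0 <= K by exact: correlation_const_ge0.
have m0 : 0 < m by lra.
have near_eps : \forall eps \near 0^'+, 0 < eps <= eps0.
  near=> eps; apply/andP; split.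
    by near: eps; exact: nbhs_right_gt.
  by near: eps; exact: nbhs_right_le.
apply: (@cvg_L2_0 _ _ _ _ (fun eps => 4 * K * T * ((delta eps ^+ 2) `^ m / eps))).
- apply: filterS near_eps => eps /andP[eps_gt0 eps_le].
  have [mV iV bV] := odd_power_time_integral_sqr_le T0 e00 mX gX iX cX eps_gt0 eps_le mn.
  pose V := time_integral (fun s w => odd_power m (cut_increment T X eps s w)).
  have -> : odd_variation X m T eps = fun w => eps^-1 * V w.
    by apply/funext => w; exact: odd_variationE.
  have sqrE w : (eps^-1 * V w) ^+ 2 = (eps ^+ 2)^-1 * V w ^+ 2.
    by rewrite exprMn exprVn.
  split; first exact: measurable_funM.
    by apply: eq_rintegrable (rintegrableZl (eps ^+ 2)^-1 iV) => w; rewrite sqrE.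
  under eq_Rintegral do rewrite sqrE.
  rewrite RintegralZl//.
  apply: le_trans (ler_wpM2l _ bV) _; first by rewrite invr_ge0 sqr_ge0.
  rewrite -/K le_eqVlt; apply/orP; left; apply/eqP; field.
  by rewrite gt_eqF.
- move=> e e0; pose q := e / (4 * K * T + 1).
  have KT0 : 0 <= 4 * K * T by rewrite mulr_ge0 ?(ltW T0)// mulr_ge0.
  have KT1 : 0 < 4 * K * T + 1 by rewrite ltr_wpDl.
  have q0 : 0 < q by rewrite divr_gt0.
  have m2 : 2 * m != 0 by rewrite mulf_neq0 ?gt_eqF.
  have c0 : 0 < q `^ (2 * m)^-1 by rewrite powR_gt0.
  move/eqoP : od => /(_ _ c0).
  apply: filterS2 near_eps => x /andP[x0 _].
  rewrite [`|_ `^ _|]ger0_norm ?powR_ge0// => dx.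
  have dm : (delta x ^+ 2) `^ m <= q * x.
    rewrite -[_ ^+ 2]real_normK ?num_real// -powR_mulrn// -powRrM.
    apply: (@le_trans _ _ ((q `^ (2 * m)^-1 * x `^ (2 * m)^-1) `^ (2 * m))).
      by rewrite ge0_ler_powR ?nnegrE ?mulr_ge0 ?powR_ge0 ?(ltW m0).
    rewrite powRM ?powR_ge0// -!powRrM mulVf// !powRr1 ?(ltW q0) ?(ltW x0)//.
  apply: (@le_trans _ _ (4 * K * T * q)).
    by rewrite ler_wpM2l// ler_pdivrMr.
  by rewrite /q mulrA ler_pdivrMr// mulrDr mulr1 [e * _]mulrC lerDl ltW.
Unshelve. all: by end_near. Qed.

End conclusion.

Theorem theorem10 (R : realType) (d : measure_display)
  (Omega : measurableType d) (P : probability Omega R)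
  (T eps0 : R) (T_gt0 : 0 < T) (eps0_gt0 : 0 < eps0)
  (X : R -> Omega -> R)
  (X_measurable : measurable_process (T + eps0) X)
  (X_gaussian : centered_gaussian_process P (T + eps0) X)
  (X_wiener : wiener_representation P (T + eps0) X)
  (delta : R -> R)
  (delta_ge0 : {in `[0, T + eps0], forall r, 0 <= delta r})
  (X_increments : {in `[0, T + eps0] &, forall s t,
    ('E_P[fun w => ((X t w - X s w) ^+ 2)%R])%E = (delta `|t - s| ^+ 2)%:E})
  (delta2_increasing :
    {in `[0, T + eps0] &, nondecreasing_fun (fun r => delta r ^+ 2)})
  (delta2_concave : concave_on (T + eps0) (fun r => delta r ^+ 2))
  (m : R) (m_gt1 : 1 < m) :
  (m \isn't a Num.int ->
    (delta : R -> R^o) =o_ (0^'+) (fun r : R => r `^ (2 * m)^-1 : R^o) ->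
    condition_S (T + eps0) (fun r => delta r ^+ 2) ->
    zero_odd_variation P X m T) /\
  (m \is a Num.int ->
    (delta : R -> R^o) =o_ (0^'+) (fun r : R => r `^ (2 * m)^-1 : R^o) ->
    zero_odd_variation P X m T).
Proof.
by split=> _ small *; exact: (zero_odd_variation_concave T_gt0 eps0_gt0
  X_measurable X_gaussian X_increments delta2_concave m_gt1 small).
Qed.
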